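(* Let $R$ be an order in a finite product of number fields $K$ and $\mathfrak{l}$ a singular maximal ideal of $R$. Assume that $R$ has an $\mathfrak{l}$-multiplicator ladder, and let $\mathcal{O}_d\subsetneq\cdots\subsetneq\mathcal{O}_0$ be an $\mathfrak{l}$-multiplicator ladder in the set of overorders of $R$. (a) For $2\le i\le d$, $$\frac{\#\mathrm{Cl}(\mathcal{O}_i)}{\#\mathrm{Cl}(\mathcal{O}_{i-1})}=\frac{\#(R/\mathfrak{l})}{[\mathcal{O}_{i-1}^\times:\mathcal{O}_i^\times]}.$$ (b) If $R$ is Bass at $\mathfrak{l}$, then $$\frac{\#\mathrm{Cl}(\mathcal{O}_1)}{\#\mathrm{Cl}(\mathcal{O}_0)}=\frac{\#(R/\mathfrak{l})-\delta_\mathfrak{l}}{[\mathcal{O}_0^\times:\mathcal{O}_1^\times]},$$ where $\delta_\mathfrak{l}=-1,0,1$ if $\mathfrak{l}$ is inert, ramified, or split in $\mathcal{O}_0$, respectively.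
   Context: $(L:L')=\{x\in K:xL'\subseteq L\}$; conductor $\mathfrak{f}_S=(S:\mathcal{O}_K)$; a maximal ideal of $S$ is singular if it contains $\mathfrak{f}_S$. $\mathrm{Cl}(S)$ is the group of invertible fractional $S$-ideals modulo principal fractional ideals. An $\mathfrak{l}$-overorder of $R$ is an overorder $S$ with $(R:S)=R$ or $(R:S)$ $\mathfrak{l}$-primary. $S$ is Gorenstein at a maximal ideal $\mathfrak{m}$ if $\dim_{S/\mathfrak{m}}((S:\mathfrak{m})/S)=1$; $R$ is Bass at $\mathfrak{l}$ if every overorder of $R$ is Gorenstein at every one of its maximal ideals above $\mathfrak{l}$. A chain $R=R_d\subsetneq\cdots\subsetneq R_0$ is the $\mathfrak{l}$-multiplicator ladder of $R$ if $R_d,\ldots,R_0$ are all the $\mathfrak{l}$-overorders of $R$ and for $1\le i\le d$, $R_i$ has a unique maximal ideal $\mathfrak{L}_i$ above $\mathfrak{l}$, it is singular, and $R_{i-1}=(\mathfrak{L}_i:\mathfrak{L}_i)$ is the unique minimal $\mathfrak{l}$-overorder of $R_i$ (no order strictly in between). An $\mathfrak{l}$-multiplicator ladder in the set of overorders of $R$ is a chain $\mathcal{O}_d\subsetneq\cdots\subsetneq\mathcal{O}_0$ with $\mathcal{O}_d$ an overorder of $R$ satisfying $(\mathcal{O}_d)_\mathfrak{l}=R_\mathfrak{l}$ and forming the $\mathfrak{l}\mathcal{O}_d$-multiplicator ladder of $\mathcal{O}_d$. ''$\mathfrak{l}$ inert/ramified/split in $\mathcal{O}_0$'' means that $\mathfrak{l}\mathcal{O}_0$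 (which equals the unique maximal ideal of $\mathcal{O}_1$ above $\mathfrak{l}$) is, respectively, a maximal ideal of $\mathcal{O}_0$, the square of a maximal ideal of $\mathcal{O}_0$, or the product of two distinct maximal ideals of $\mathcal{O}_0$. *)

(* Defs.v *)
From HB Require Import structures.
From mathcomp Require Import all_boot all_order all_algebra all_field.
From mathcomp Require Import finmap.
From mathcomp Require Import boolp classical_sets functions cardinality.

Set Implicit Arguments.
Unset Strict Implicit.
Unset Printing Implicit Defensive.

Import GRing.Theory.
Local Open Scope classical_set_scope.
Local Open Scope ring_scope.

(* The projections p identify K with the product of the F i as a ring; the
   Q-algebra structures are then determined.  Finite-dimensional field
   extensions of rat are exactly the number fields. *)
Definition product_of_number_fields (K : comNzRingType) : Prop :=
  exists (n : nat) (F : 'I_n -> fieldExtType rat)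
         (p : forall i, {rmorphism K -> F i}),
    (forall x y, (forall i, p i x = p i y) -> x = y) /\
    (forall y : forall i, F i, exists x, forall i, p i x = y i).

(* Cardinality, with value 0 on infinite sets. *)
Definition ncard (T : choiceType) (A : set T) : nat := #|` fset_set A|.

(* Number of classes op g H, for g in G: when H is a subgroup of the abelian
   group (G, op), this is the order of G / H, i.e. the index [G : H]. *)
Definition quotient_card (T : choiceType) (op : T -> T -> T) (G H : set T) : nat :=
  ncard [set [set op g h | h in H] | g in G].

Section Orders.
Variable K : comNzRingType.
Implicit Types R S T I J L M l m : set K.

(* Finitely generated subgroups of K spanning K over the rationals. *)
Definition lattice L : Prop :=
  (exists (n : nat) (b : 'I_n -> K),
     L = [set x | exists c : 'I_n -> int, x = \sum_i b i *~ c i]) /\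
  (forall x, exists2 k : nat, (0 < k)%N & L (x *+ k)).

Definition is_order R : Prop := GRing.subring_closed (mem R) /\ lattice R.

Definition overorder R S : Prop := is_order S /\ R `<=` S.

Definition max_order : set K := [set x | integralOver (intr : int -> K) x].

Definition colon L L' : set K := [set x | forall y, L' y -> L (x * y)].

Definition set_prod I J : set K :=
  [set x | exists (n : nat) (a b : 'I_n -> K),
     (forall i, I (a i) /\ J (b i)) /\ x = \sum_i a i * b i].

Definition ideal S I : Prop :=
  [/\ GRing.zmod_closed (mem I), I `<=` S
    & forall s x, S s -> I x -> I (s * x)].

Definition maximal_ideal S M : Prop :=
  [/\ ideal S M, M <> S
    & forall J, ideal S J -> M `<=` J -> J = M \/ J = S].

Definition primary_ideal S Q : Prop :=
  [/\ ideal S Q, Q <> S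
    & forall x y, S x -> S y -> Q (x * y) -> Q x \/ exists n : nat, Q (y ^+ n)].

Definition radical S I : set K := [set x | S x /\ exists n : nat, I (x ^+ n)].

Definition primary_to S l Q : Prop := primary_ideal S Q /\ radical S Q = l.

Definition conductor S : set K := colon S max_order.

Definition singular_maximal_ideal S M : Prop := maximal_ideal S M /\ conductor S `<=` M.

Definition lies_above R l M : Prop := M `&` R = l.

Definition local_overorder R l S : Prop :=
  overorder R S /\ (colon R S = R \/ primary_to R l (colon R S)).

(* When m * L is contained in L', L / L' is a vector space over S / m; the
   condition says that it has a basis of n elements. *)
Definition has_quotient_dim S m L L' (n : nat) : Prop :=
  exists b : 'I_n -> K,
    [/\ forall i, L (b i),
        forall x, L x -> exists s : 'I_n -> K,
          (forall i, S (s i)) /\ L' (x - \sum_i s i * b i)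
      & forall s : 'I_n -> K, (forall i, S (s i)) ->
          L' (\sum_i s i * b i) -> forall i, m (s i)].

Definition gorenstein_at S m : Prop := has_quotient_dim S m (colon S m) S 1.

Definition bass_at R l : Prop :=
  forall S M, overorder R S -> maximal_ideal S M -> lies_above R l M ->
    gorenstein_at S M.

Definition minimal_local_overorder S l T : Prop :=
  [/\ local_overorder S l T, S `<` T
    & forall U, is_order U -> S `<` U -> ~ U `<` T].

(* Only the terms C 0, ..., C d of the sequence C are relevant. *)
Definition multiplicator_ladder R l (d : nat) (C : nat -> set K) : Prop :=
  [/\ C d = R,
      forall i, (i < d)%N -> C i.+1 `<` C i,
      forall S, local_overorder R l S <-> (exists2 i, (i <= d)%N & S = C i)
    & forall i, (1 <= i <= d)%N -> exists M,
        [/\ maximal_ideal (C i) M /\ lies_above R l M,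
            forall M', maximal_ideal (C i) M' -> lies_above R l M' -> M' = M,
            singular_maximal_ideal (C i) M,
            C i.-1 = colon M M
          & minimal_local_overorder (C i) M (C i.-1) /\
            forall T, minimal_local_overorder (C i) M T -> T = C i.-1]].

(* The class of x / s in the localization of K at the multiplicative set
   R \ l, which may contain zero divisors of K. *)
Definition loc_frac R l (x s : K) : set (K * K) :=
  [set yt | (R `\` l) yt.2 /\
     exists2 u, (R `\` l) u & u * (yt.2 * x - s * yt.1) = 0].

Definition localization R l M : set (set (K * K)) :=
  [set c | exists x s, [/\ M x, (R `\` l) s & c = loc_frac R l x s]].

Definition ladder_in_overorders R l (d : nat) (O : nat -> set K) : Prop :=
  [/\ overorder R (O d),
      localization R l (O d) = localization R l R
    & multiplicator_ladder (O d) (set_prod l (O d)) d O].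

Definition fractional_ideal S I : Prop :=
  lattice I /\ forall s x, S s -> I x -> I (s * x).

Definition invertible_ideals S : set (set K) :=
  [set I | fractional_ideal S I /\
     exists2 J, fractional_ideal S J & set_prod I J = S].

Definition principal_ideals S : set (set K) :=
  [set I | exists x, (exists y, x * y = 1) /\ I = [set x * s | s in S]].

Definition class_number S : nat :=
  quotient_card set_prod (invertible_ideals S) (principal_ideals S).

Definition units S : set K := [set x | S x /\ exists2 y, S y & x * y = 1].

Definition unit_index S T : nat := quotient_card *%R (units S) (units T).

Definition residue_card R l : nat := quotient_card +%R R l.

Definition inert_in l S : Prop := maximal_ideal S (set_prod l S).

Definition ramified_in l S : Prop :=
  exists2 M, maximal_ideal S M & set_prod l S = set_prod M M.

Definition split_in l S : Prop :=
  exists M N, [/\ maximal_ideal S M, maximal_ideal S N, M <> N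
                & set_prod l S = set_prod M N].

Definition splitting_symbol l S (delta : int) : Prop :=
  [\/ inert_in l S /\ delta = -1,
      ramified_in l S /\ delta = 0
    | split_in l S /\ delta = 1].

End Orders.

(* Main.v *)
(* Let T = O_i, S = O_(i-1), and let M be the maximal ideal of T above l, so that
   S = (M : M) and M is an ideal of S.  Extension I |-> I S maps Cl(T) onto Cl(S),
   and the invertible T-ideals I with I S = S are the lines s T + M with s a unit
   modulo M; as S^*/T^* acts freely on them with orbits the classes in the kernel,
   h(T) / h(S) = #{lines} / [S^* : T^*].  Here S / M is a quadratic algebra over
   T / M = R / l: the lines are those through 1 + b x, so #(R / l) of them, when it
   is local but not a field; #(R / l) + 1 when it is a field; #(R / l) - 1 when it
   is split.  For i >= 2 it is local and not a field because there is no order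
   strictly between T and S and a further order lies above S; for i = 1 its
   dimension is 2 by the Gorenstein property, and l S = M.

   As infinite cardinals count as 0, Cl must be shown to be finite.  This follows
   Hurwitz: if the norm is at least 1 in absolute value on the invertible elements of
   an S-module I containing 1, the pigeonhole principle gives c I <= S with c > 0
   depending only on S.  The same bound for the integral closure I shows that
   conductors contain a positive integer, which excludes d = 0. *)

Require Import Defs.
From HB Require Import structures.
From mathcomp Require Import all_boot all_order all_algebra all_field.
From mathcomp Require Import finmap perm.
From mathcomp Require Import boolp classical_sets functions cardinality.
From mathcomp Require Import zify ring.

Set Implicit Arguments.
Unset Strict Implicit.
Unset Printing Implicit Defensive.

Import Order.TTheory GRing.Theory Num.Theory.
Local Open Scope classical_set_scope.
Local Open Scope ring_scope.

(** * Counting classes *)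

Section Counting.
Local Open Scope card_scope.

Lemma card_eq_finite (U V : Type) (A : set U) (B : set V) :
  A #= B -> finite_set A -> finite_set B.
Proof. by move=> eqAB [n An]; exists n; rewrite -(card_eql eqAB). Qed.

Lemma card_eq_ncard (T U : choiceType) (A : set T) (B : set U) :
  A #= B -> ncard A = ncard B.
Proof.
move=> eqAB; have [finA|infA] := pselect (finite_set A).
  exact/(fcard_eq finA (card_eq_finite eqAB finA)).
have infB : infinite_set B.
  by move=> finB; apply/infA/(card_eq_finite _ finB); rewrite card_eq_sym.
by rewrite /ncard /fset_set; do 2!case: pselect => // ?.
Qed.

Lemma card_eq_images (I : choiceType) (T U : Type) (A : set I) (F : I -> T)
    (G : I -> U) :
  (forall a b, A a -> A b -> (F a = F b <-> G a = G b)) -> F @` A #= G @` A.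
Proof.
move=> FG; have [->|/set0P[a0 Aa0]] := eqVneq A set0;
  first by rewrite !image_set0 card_eq00.
pose rep a := xget a0 [set b | A b /\ F b = F a].
have repP a : A a -> A (rep a) /\ F (rep a) = F a.
  by move=> Aa; rewrite /rep; case: xgetP => [b _ //|/(_ a)]; case; split.
have rep_eq a b : F a = F b -> rep a = rep b by rewrite /rep => ->.
pose A' := rep @` A.
have A'A a : A' a -> A a by case=> b /repP[? _] <-.
have FA' : F @` A' = F @` A.
  apply/seteqP; split=> _ [a Aa <-]; first by exists a => //; apply: A'A.
  by exists (rep a); [exists a|case: (repP a Aa)].
have GA' : G @` A' = G @` A.
  apply/seteqP; split=> _ [a Aa <-]; first by exists a => //; apply: A'A.
  by have [? ?] := repP a Aa; exists (rep a); [exists a|apply/(FG _ _)].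
have injF : {in A' &, injective F}.
  move=> a b; rewrite !inE => -[c Ac <-] [e Ae <-].
  by have [_ ->] := repP c Ac; have [_ ->] := repP e Ae => /rep_eq ->.
have injG : {in A' &, injective G}.
  move=> a b Aa Ab Gab; apply: injF => //; move: Aa Ab; rewrite !inE => Aa Ab.
  by apply/FG => //; apply: A'A.
rewrite -FA' -GA'; apply: (card_eq_trans (inj_card_eq injF)).
by rewrite card_eq_sym; apply: inj_card_eq.
Qed.

Lemma card_eq_image_of (I : choiceType) (J T U : Type) (A : set I)
    (B : set J) (F : I -> T) (G : J -> U) (f : I -> J) :
  (forall a, A a -> B (f a)) ->
  (forall b, B b -> exists2 a, A a & G b = G (f a)) ->
  (forall a a', A a -> A a' -> (F a = F a' <-> G (f a) = G (f a'))) ->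
  F @` A #= G @` B.
Proof.
move=> fAB sur FG; have -> : G @` B = (G \o f) @` A.
  apply/seteqP; split=> u; first by case=> b /sur[a Aa ->] <-; exists a.
  by case=> a Aa <-; exists (f a); first exact: fAB.
exact: card_eq_images.
Qed.

Lemma ncard_image_of (I : choiceType) (J : Type) (T U : choiceType) (A : set I)
    (B : set J) (F : I -> T) (G : J -> U) (f : I -> J) :
  (forall a, A a -> B (f a)) ->
  (forall b, B b -> exists2 a, A a & G b = G (f a)) ->
  (forall a a', A a -> A a' -> (F a = F a' <-> G (f a) = G (f a'))) ->
  ncard (F @` A) = ncard (G @` B).
Proof. by move=> fAB sur FG; apply: card_eq_ncard;
  apply: card_eq_image_of fAB sur FG. Qed.

Lemma ncard_fibers (I T U : choiceType) (A : set I) (F : I -> T) (G : I -> U)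
    (c : nat) :
  finite_set (F @` A) ->
  (forall a b, A a -> A b -> F a = F b -> G a = G b) ->
  (forall a, A a -> ncard (F @` [set b | A b /\ G b = G a]) = c) ->
  ncard (F @` A) = (c * ncard (G @` A))%N.
Proof.
move=> finFA FG fib.
have [->|/set0P[a0 Aa0]] := eqVneq A set0.
  by rewrite !image_set0 /ncard !fset_set0 !cardfs0 muln0.
pose g t := G (xget a0 [set b | A b /\ F b = t]).
have gF a : A a -> g (F a) = G a.
  move=> Aa; rewrite /g; case: xgetP => [b _ [Ab Fb]|/(_ a)]; last by case; split.
  exact: FG.
have GA : G @` A = g @` (F @` A).
  apply/seteqP; split=> u; first by case=> a Aa <-; exists (F a); [exists a|apply: gF].
  by case=> _ [a Aa <-] <-; exists a => //; rewrite gF.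
rewrite /ncard GA (fset_set_image g finFA); set X := fset_set (F @` A).
have XE t : (t \in X) = (t \in F @` A) by rewrite in_fset_set.
rewrite (card_fset_sum1 X) /=.
have -> : (\sum_(i <- X) 1 = \sum_(u <- [fset g t | t in X]%fset) c)%N.
  rewrite (partition_big_imfset _ g) /=; apply: eq_big_seq => u.
  case/imfsetP => t /=; rewrite XE inE => -[a Aa <-] ->.
  rewrite -[RHS](fib a Aa) /ncard card_fset_sum1 /= gF//.
  rewrite -big_filter; apply: perm_big.
  apply: uniq_perm; [by rewrite filter_uniq|exact: fset_uniq|].
  have fin2 : finite_set (F @` [set b | A b /\ G b = G a]).
    by apply: sub_finite_set finFA => _ [b [Ab _] <-]; exists b.
  move=> s; rewrite mem_filter XE; apply/idP/idP.
    case/andP => /eqP gs; rewrite inE => -[b Ab bs].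
    by rewrite in_fset_set // inE; exists b => //; split=> //; rewrite -gF // bs.
  by rewrite in_fset_set // inE => -[b [Ab Gb] <-]; rewrite gF // Gb eqxx inE; exists b.
by rewrite big_const_seq count_predT iter_addn_0.
Qed.

Lemma ncard_gt0 (T : choiceType) (A : set T) a :
  finite_set A -> A a -> (0 < ncard A)%N.
Proof. by move=> finA Aa; rewrite cardfs_gt0; apply/fset0Pn; exists a;
  rewrite in_fset_set ?inE. Qed.

Lemma ncard_setU1 (T : choiceType) (A : set T) a :
  finite_set A -> ~ A a -> ncard (a |` A) = (ncard A).+1.
Proof.
move=> finA Aa; rewrite /ncard fset_setU1 // cardfsU1 in_fset_set //.
by rewrite memNset.
Qed.

End Counting.

(** * Lattices and orders *)

Section Subgroups.
Variable K : comNzRingType.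
Implicit Types (L P G I J S T : set K) (x y z : K).

Definition zgroup L := L 0 /\ forall x y, L x -> L y -> L (x - y).

Lemma zmod_closedE L : GRing.zmod_closed (mem L) <-> zgroup L.
Proof.
split=> -[L0 LB]; split; try by move: L0; rewrite !inE.
  by move=> x y Lx Ly; have := LB x y; rewrite !inE; apply.
by move=> x y; rewrite !inE; apply: LB.
Qed.

Definition coset P x : set K := [set x + h | h in P].

Definition unitK x := exists y, x * y = 1.

Section ZGroup.
Variable L : set K.
Hypothesis grpL : zgroup L.

Lemma zgroup0 : L 0. Proof. by case: grpL. Qed.
Lemma zgroupB x y : L x -> L y -> L (x - y). Proof. by case: grpL => _; apply. Qed.
Lemma zgroupN x : L x -> L (- x).
Proof. by rewrite -sub0r; apply: zgroupB; apply: zgroup0. Qed.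
Lemma zgroupD x y : L x -> L y -> L (x + y).
Proof. by move=> Lx Ly; rewrite -[y]opprK; apply/zgroupB/zgroupN. Qed.
Lemma zgroup_sum (A : Type) (r : seq A) (Q : pred A) (F : A -> K) :
  (forall i, Q i -> L (F i)) -> L (\sum_(i <- r | Q i) F i).
Proof. by move=> LF; elim/big_ind: _ => //; [apply: zgroup0|apply: zgroupD]. Qed.
Lemma zgroupMn x n : L x -> L (x *+ n).
Proof. by move=> Lx; elim: n => [|n IH]; rewrite ?mulr0n ?mulrS;
  [apply: zgroup0|apply: zgroupD]. Qed.
Lemma zgroupMz x m : L x -> L (x *~ m).
Proof.
case: m => n Lx; first by rewrite -pmulrn; apply: zgroupMn.
by rewrite NegzE mulrNz -pmulrn; apply/zgroupN/zgroupMn.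
Qed.
Lemma zgroup_addK x y : L y -> (L (x + y) <-> L x).
Proof. by move=> Ly; split=> [|Lx]; [move=> /zgroupB/(_ Ly);
  rewrite addrK|apply: zgroupD]. Qed.

Lemma coset_eq x y : coset L x = coset L y <-> L (x - y).
Proof.
split=> [cxy|Lxy].
  have : coset L x x by exists 0; [apply: zgroup0|rewrite addr0].
  by rewrite cxy => -[h Lh <-]; rewrite addrAC subrr add0r.
apply/seteqP; split=> _ [h Lh <-].
  by exists (x - y + h); [apply: zgroupD|ring].
by exists (h - (x - y)); [apply: zgroupB|ring].
Qed.

End ZGroup.

Section Span.
Variables (A : finType) (b : A -> K).

Definition zspan : set K := [set x | exists c : A -> int, x = \sum_i b i *~ c i].

Lemma zspan_zgroup : zgroup zspan.
Proof.
split; first by exists (fun=> 0); rewrite big1.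
move=> _ _ [c ->] [d ->]; exists (fun i => c i - d i).
by rewrite -sumrB; apply: eq_bigr => i _; rewrite mulrzBr.
Qed.

Lemma zspan_gen i : zspan (b i).
Proof.
exists (fun j => (j == i)%:Z); rewrite (bigD1 i) //= eqxx big1 ?addr0 // => j /negPf ->.
by rewrite mulr0z.
Qed.

Lemma zspan_sub L : zgroup L -> (forall i, L (b i)) -> zspan `<=` L.
Proof. by move=> gL Lb _ [c ->]; apply: zgroup_sum => // i _; apply: zgroupMz. Qed.

Lemma zspan_ord : exists (n : nat) (b' : 'I_n -> K),
  zspan = [set x | exists c : 'I_n -> int, x = \sum_i b' i *~ c i].
Proof.
exists #|A|, (b \o enum_val); apply/seteqP; split=> _ [c ->].
  exists (c \o enum_val) => /=; rewrite (reindex (@enum_val A predT)) //=.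
  by apply: onW_bij; apply: enum_val_bij.
exists (c \o enum_rank); rewrite [RHS](reindex (@enum_val A predT)) /=.
  by apply: eq_bigr => i _ /=; rewrite enum_valK.
by apply: onW_bij; apply: enum_val_bij.
Qed.

Definition residue_vec (c : nat) (e : {ffun A -> 'I_c.+1}) : K :=
  \sum_i b i *+ e i.

Lemma residue_vec_span c e : zspan (@residue_vec c e).
Proof.
apply: zgroup_sum zspan_zgroup _ _ _ _ _ => i _.
exact: (zgroupMn zspan_zgroup _ (zspan_gen i)).
Qed.

Lemma zspan_residue c x : zspan x ->
  exists e : {ffun A -> 'I_c.+1}, exists2 z, zspan z & x = residue_vec e + z *+ c.+1.
Proof.
case=> a ->; exists [ffun i => inord `|(a i %% c.+1%:Z)%Z|%N].
exists (\sum_i b i *~ (a i %/ c.+1%:Z)%Z); first by exists (fun i => (a i %/ c.+1%:Z)%Z).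
rewrite -sumrMnl -big_split /=; apply: eq_bigr => i _.
rewrite ffunE [in LHS](divz_eq (a i) c.+1%:Z) mulrzDr addrC mulrzA -pmulrn.
congr (_ + _); rewrite inordK; last by rewrite -ltz_nat gez0_abs ?modz_ge0 ?ltz_mod.
by rewrite pmulrn gez0_abs // modz_ge0.
Qed.

End Span.

Lemma lattice_zgroup L : lattice L -> zgroup L.
Proof. by case=> -[n [b ->]] _; apply: zspan_zgroup. Qed.

Lemma zspan_lattice (A : finType) (b : A -> K) :
  (forall x, exists2 k : nat, (0 < k)%N & zspan b (x *+ k)) -> lattice (zspan b).
Proof. by move=> full; split=> //; apply: zspan_ord. Qed.

Lemma lattice_reps L (c : nat) : lattice L -> (0 < c)%N ->
  exists rs : seq K, (forall r, r \in rs -> L r) /\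
    forall x, L x -> exists2 r, r \in rs & exists2 z, L z & x = r + z *+ c.
Proof.
case: c => // c [[n [b ->]] _] _.
exists [seq residue_vec b e | e : {ffun 'I_n -> 'I_c.+1}]; split.
  by move=> r /mapP[e _ ->]; apply: residue_vec_span.
by move=> x /(zspan_residue c)[e [z Lz ->]]; exists (residue_vec b e);
  [apply: map_f; rewrite mem_enum|exists z].
Qed.

Lemma sublattice L G (c : nat) : lattice L -> (0 < c)%N -> zgroup G ->
  G `<=` L -> (forall x, L x -> G (x *+ c)) -> lattice G.
Proof.
case: c => // c latL _ grpG GL LG; case: (latL) => -[n [b defL]] full.
pose g (u : 'I_n + {ffun 'I_n -> 'I_c.+1}) : K :=
  match u with inl i => b i *+ c.+1
  | inr e => if `[< G (residue_vec b e) >] then residue_vec b e else 0 end.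
suff -> : G = zspan g.
  apply: zspan_lattice => x; have [k k_gt0 Lkx] := full x.
  exists (k * c.+1)%N; rewrite ?muln_gt0 ?k_gt0 // mulrnA.
  move: Lkx; rewrite -/(zspan b) in defL *; rewrite defL => -[a ->].
  rewrite -sumrMnl; apply: zgroup_sum (zspan_zgroup g) _ _ _ _ _ => i _.
  rewrite pmulrn mulrzAC -pmulrn; apply: (zgroupMz (zspan_zgroup g)).
  exact: (zspan_gen g (inl i)).
rewrite -/(zspan b) in defL.
apply/seteqP; split=> [x Gx|].
  have : zspan b x by rewrite -defL; apply: GL.
  move=> /(zspan_residue c)[e [z Lz xE]].
  have Gz : G (z *+ c.+1) by apply: LG; rewrite defL.
  have Ge : G (residue_vec b e) by move: Gx; rewrite xE => /(zgroup_addK grpG _ Gz).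
  rewrite xE; apply: (zgroupD (zspan_zgroup g)).
    have := zspan_gen g (inr e); rewrite /g; case: asboolP => //.
  case: Lz => a ->; rewrite -sumrMnl.
  apply: zgroup_sum (zspan_zgroup g) _ _ _ _ _ => i _.
  rewrite pmulrn mulrzAC -pmulrn; apply: (zgroupMz (zspan_zgroup g)).
  exact: (zspan_gen g (inl i)).
apply: zspan_sub => // -[i|e] /=; last by case: asboolP => // _; apply: zgroup0.
by apply: LG; rewrite defL; apply: zspan_gen.
Qed.

Lemma finite_cosets L P (c : nat) : lattice L -> (0 < c)%N -> zgroup P ->
  (forall x, L x -> P (x *+ c)) -> finite_set [set coset P x | x in L].
Proof.
move=> latL c_gt0 grpP LP; have [rs [_ rsP]] := lattice_reps latL c_gt0.
have finrs : finite_set [set` rs] by [].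
apply: sub_finite_set (finite_image (coset P) finrs) => _ [x Lx <-].
have [r r_rs [z Lz ->]] := rsP x Lx; exists r => //.
by apply/coset_eq => //; rewrite opprD addNKr; apply: zgroupN => //; apply: LP.
Qed.

Lemma finite_intermediate_groups L (c : nat) : lattice L -> (0 < c)%N ->
  finite_set [set G | [/\ zgroup G, G `<=` L & forall x, L x -> G (x *+ c)]].
Proof.
move=> latL c_gt0; have [rs [_ rsP]] := lattice_reps latL c_gt0.
pose H (A : {set 'I_(size rs)}) : set K :=
  [set x | exists2 i, i \in A & exists2 z, L z & x = rs`_i + z *+ c].
apply: sub_finite_set (finite_image H (@finite_finset _ [set: {set 'I_(size rs)}]))
  => G [grpG GL LG].
exists [set i : 'I_(size rs) | `[< G rs`_i >]]%SET => //.
apply/seteqP; split=> [x [i]|x Gx].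
  by rewrite inE => /asboolP Gi [z Lz ->]; apply: (zgroupD grpG) => //; apply: LG.
have [r /(nthP 0)[i lti <-] [z Lz xE]] := rsP x (GL x Gx).
exists (Ordinal lti); last by exists z.
by rewrite inE /=; apply/asboolP; move: Gx; rewrite xE => /(zgroup_addK grpG _ (LG _ Lz)).
Qed.

Section SetProd.

Lemma set_prodM I J x y : I x -> J y -> set_prod I J (x * y).
Proof. by move=> Ix Jy; exists 1%N, (fun=> x), (fun=> y); rewrite big_ord1. Qed.

Lemma set_prod_ind I J (P : K -> Prop) :
  P 0 -> (forall x y, P x -> P y -> P (x + y)) ->
  (forall a b, I a -> J b -> P (a * b)) -> forall x, set_prod I J x -> P x.
Proof.
move=> P0 PD PM _ [n [a [b [ab ->]]]]; elim/big_ind: _ => // i _.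
by case: (ab i) => ? ?; apply: PM.
Qed.

Lemma set_prod0 I J : set_prod I J 0.
Proof. by exists 0%N, (fun=> 0), (fun=> 0); split; [case|rewrite big_ord0]. Qed.

Lemma set_prodD I J x y : set_prod I J x -> set_prod I J y -> set_prod I J (x + y).
Proof.
move=> [n [a [b [ab ->]]]] [m [a' [b' [ab' ->]]]]; exists (n + m)%N.
exists (fun i : 'I_(n + m) => match fintype.split i with inl j => a j | inr j => a' j end).
exists (fun i : 'I_(n + m) => match fintype.split i with inl j => b j | inr j => b' j end).
split; first by move=> i; case: (fintype.split i).
rewrite big_split_ord /=; congr (_ + _); apply: eq_bigr => i _.
  by rewrite (unsplitK (inl i : 'I_n + 'I_m)).
by rewrite (unsplitK (inr i : 'I_n + 'I_m)).
Qed.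

Lemma set_prod_sub I J L : zgroup L -> (forall a b, I a -> J b -> L (a * b)) ->
  set_prod I J `<=` L.
Proof. by move=> gL IJL; apply: (@set_prod_ind I J L);
  [exact: zgroup0|exact: zgroupD|]. Qed.

Lemma set_prodC I J : set_prod I J = set_prod J I.
Proof.
suff sub (A B : set K) : set_prod A B `<=` set_prod B A by apply/seteqP.
apply: (@set_prod_ind A B (set_prod B A)); [exact: set_prod0|exact: set_prodD|].
by move=> a b Aa Bb; rewrite mulrC; apply: set_prodM.
Qed.

Lemma set_prodA I J L : set_prod I (set_prod J L) = set_prod (set_prod I J) L.
Proof.
have sub (A B C : set K) : set_prod A (set_prod B C) `<=` set_prod (set_prod A B) C.
  apply: (@set_prod_ind _ _ (set_prod (set_prod A B) C));
    [exact: set_prod0|exact: set_prodD|].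
  move=> a x Aa.
  move: x; apply: set_prod_ind; first by rewrite mulr0; apply: set_prod0.
    by move=> x y ? ?; rewrite mulrDr; apply: set_prodD.
  by move=> b c Bb Cc; rewrite mulrA; apply: set_prodM => //; apply: set_prodM.
apply/seteqP; split=> //.
by rewrite set_prodC (set_prodC I J) (set_prodC I _) (set_prodC J L); apply: sub.
Qed.

Lemma set_prodACA (A B C D : set K) :
  set_prod (set_prod A B) (set_prod C D) = set_prod (set_prod A C) (set_prod B D).
Proof. by rewrite -!set_prodA (set_prodA B) (set_prodC B C) -set_prodA. Qed.

Lemma set_prodS (A B C D : set K) : A `<=` C -> B `<=` D -> set_prod A B `<=` set_prod C D.
Proof.
move=> AC BD; apply: (@set_prod_ind _ _ (set_prod C D));
  [exact: set_prod0|exact: set_prodD|].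
by move=> a b /AC ? /BD ?; apply: set_prodM.
Qed.

Lemma set_prod_zgroup I J : zgroup I -> zgroup (set_prod I J).
Proof.
move=> gI; split=> [|x y IJx IJy]; first exact: set_prod0.
apply: set_prodD => //; move: y IJy; apply: set_prod_ind.
- by rewrite oppr0; apply: set_prod0.
- by move=> y z ? ?; rewrite opprD; apply: set_prodD.
by move=> a b Ia Jb; rewrite -mulNr; apply: set_prodM => //; apply: zgroupN.
Qed.

End SetProd.

Record subring S : Prop := Subring {
  subring_zgroup : zgroup S;
  subring1 : S 1;
  subringM : forall x y, S x -> S y -> S (x * y) }.

Lemma subring_closedE S : GRing.subring_closed (mem S) <-> subring S.
Proof.
split=> [[S1 SB SM]|[gS S1 SM]].
  have SB' x y : S x -> S y -> S (x - y) by have := SB x y; rewrite !inE.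
  have S1' : S 1 by move: S1; rewrite inE.
  split=> //; last by move=> x y; have := SM x y; rewrite !inE.
  by split=> //; rewrite -(subrr 1); apply: SB'.
by split; [rewrite inE|move=> x y; rewrite !inE; apply: zgroupB
  |move=> x y; rewrite !inE; apply: SM].
Qed.

Lemma orderE S : is_order S <-> subring S /\ lattice S.
Proof. by split=> -[? ?]; split=> //; apply/subring_closedE. Qed.

Lemma order_subring S : is_order S -> subring S.
Proof. by case/orderE. Qed.

Lemma order_lattice S : is_order S -> lattice S.
Proof. by case/orderE. Qed.

Lemma subringX S x n : subring S -> S x -> S (x ^+ n).
Proof.
move=> rS Sx; elim: n => [|n IH]; first by rewrite expr0; apply: subring1.
by rewrite exprS; apply: subringM.
Qed.

Lemma subring_nat S n : subring S -> S n%:R.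
Proof. by move=> rS; apply: zgroupMn (subring_zgroup rS) _ _ _; apply: subring1. Qed.

Definition submod S I := zgroup I /\ forall s x, S s -> I x -> I (s * x).

Lemma subring_submod S : subring S -> submod S S.
Proof. by move=> rS; split; [apply: subring_zgroup|apply: subringM]. Qed.

Lemma idealE S I : ideal S I <-> submod S I /\ I `<=` S.
Proof.
by split=> [[/zmod_closedE ? ? ?]|[[? ?] ?]]; split=> //; apply/zmod_closedE.
Qed.

Lemma fractional_idealE S I : fractional_ideal S I <-> lattice I /\ submod S I.
Proof.
by split=> [[? ?]|[? [? ?]]]; split=> //; split=> //; apply: lattice_zgroup.
Qed.

Lemma set_prod_submod S I J : submod S I -> submod S (set_prod I J).
Proof.
move=> [gI SI]; split; first exact: set_prod_zgroup.
move=> s x Ss; move: x; apply: set_prod_ind; first by rewrite mulr0; apply: set_prod0.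
  by move=> x y ? ?; rewrite mulrDr; apply: set_prodD.
by move=> a b Ia Jb; rewrite mulrA; apply: set_prodM => //; apply: SI.
Qed.

Lemma set_prod_idl S I : submod S I -> S 1 -> set_prod I S = I.
Proof.
move=> [gI SI] S1; apply/seteqP; split.
  by apply: set_prod_sub => // a b Ia Sb; rewrite mulrC; apply: SI.
by move=> x Ix; rewrite -[x]mulr1; apply: set_prodM.
Qed.

Lemma submod_sub1 S I : submod S I -> I 1 -> S `<=` I.
Proof. by move=> [_ SI] I1 s Ss; rewrite -[s]mulr1; apply: SI. Qed.

End Subgroups.

(** * Norms and the finiteness of the class group *)

Section RationalMatrices.

Lemma mulmxzE (V : zmodType) m n (M : 'M[V]_(m, n)) (d : int) i j :
  (M *~ d) i j = M i j *~ d.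
Proof. by case: d => k; rewrite ?NegzE ?mulrNz ?mxE -!pmulrn mulmxnE. Qed.

Lemma common_denominator (A : finType) (f : A -> rat) :
  exists2 D : nat, (0 < D)%N & forall a, f a * D%:R \is a Num.int.
Proof.
exists (\prod_a `|denq (f a)|)%N.
  by apply: prodn_gt0 => a; rewrite absz_gt0 denq_neq0.
move=> a; rewrite (bigD1 a) //= natrM mulrA rpredM ?rpred_nat //.
have -> : f a * `|denq (f a)|%:R = (numq (f a))%:~R.
  rewrite -{1}[f a]divq_num_den pmulrn gez0_abs ?denq_ge0 // divfK //.
  by rewrite intr_eq0 denq_neq0.
exact: intr_int.
Qed.

Lemma det_int n (M : 'M[rat]_n) :
  (forall i j, M i j \is a Num.int) -> \det M \is a Num.int.
Proof.
move=> Mint; apply: rpred_sum => s _; apply: rpredM; last exact: rpred_prod.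
by rewrite rpredX // rpredN rpred1.
Qed.

Lemma det_norm_le n (M : 'M[rat]_n) (e : rat) :
  (forall i j, `|M i j| <= e) -> `|\det M| <= (n`!)%:R * e ^+ n.
Proof.
move=> Me; apply: (le_trans (ler_norm_sum _ _ _)).
rewrite -card_Sn -sum1_card natr_sum mulr_suml; apply: ler_sum => s _.
rewrite normrM normrX normrN1 expr1n !mul1r normr_prod.
have -> : e ^+ n = \prod_(i < n) e by rewrite prodr_const card_ord.
by apply: ler_prod => i _; rewrite normr_ge0 Me.
Qed.

End RationalMatrices.

Section RegularRepresentation.
Variable F : fieldExtType rat.
Local Notation e := (vbasis {:F}).
Local Notation n := (\dim {:F}).

Definition mulmat (y : F) : 'M[rat]_n := \matrix_(j, k) coord e k (e`_j * y).

Lemma mulmatE y (j : 'I_n) : e`_j * y = \sum_k mulmat y j k *: e`_k.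
Proof.
rewrite {1}(coord_vbasis (memvf (e`_j * y))); apply: eq_bigr => k _.
by rewrite mxE.
Qed.

Lemma mulmatM y z : mulmat (y * z) = mulmat y *m mulmat z.
Proof.
apply/matrixP => j k; rewrite !mxE mulrA mulmatE mulr_suml linear_sum /=.
by apply: eq_bigr => i _; rewrite -scalerAl linearZ /= [mulmat z _ _]mxE.
Qed.

Lemma mulmat_is_zmod_morphism : zmod_morphism mulmat.
Proof. by move=> y z; apply/matrixP => j k; rewrite !mxE mulrBr linearB. Qed.

HB.instance Definition _ :=
  GRing.isZmodMorphism.Build F 'M[rat]_n mulmat mulmat_is_zmod_morphism.

Lemma mulmat1 : mulmat 1 = 1%:M.
Proof.
apply/matrixP => j k; rewrite !mxE mulr1.
by rewrite coord_free ?(basis_free (vbasisP _)) // eq_sym.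
Qed.

Definition fnorm y : rat := \det (mulmat y).

Lemma fnormM y z : fnorm (y * z) = fnorm y * fnorm z.
Proof. by rewrite /fnorm mulmatM det_mulmx. Qed.

Lemma fnorm_nat m : fnorm m%:R = m%:R ^+ n.
Proof.
rewrite /fnorm raddfMn /= mulmat1 -[RHS]det_scalar; congr (\det _).
by apply/matrixP => i j; rewrite mulmxnE !mxE -!mulrnA mulnC.
Qed.

Lemma mulmat_sum m (b : 'I_m -> F) (c : 'I_m -> int) :
  mulmat (\sum_j b j *~ c j) = \sum_j mulmat (b j) *~ c j.
Proof. by rewrite raddf_sum; apply: eq_bigr => j _; rewrite raddfMz. Qed.

Lemma fnorm_discrete m (b : 'I_m -> F) : exists2 D : nat, (0 < D)%N &
  forall c : 'I_m -> int, fnorm (\sum_j b j *~ c j) * D%:R \is a Num.int.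
Proof.
have [D D_gt0 DP] := common_denominator
  (fun u : 'I_m * ('I_n * 'I_n) => mulmat (b u.1) u.2.1 u.2.2).
exists (D ^ n)%N => [|c]; first by rewrite expn_gt0 D_gt0.
rewrite natrX mulrC -detZ; apply: det_int => i j.
rewrite mxE mulmat_sum summxE mulr_sumr; apply: rpred_sum => k _.
rewrite mulmxzE mulrzAr mulrC rpredMz //; exact: (DP (k, (i, j))).
Qed.

Lemma fnorm_small m (b : 'I_m -> F) : exists2 B : nat, (0 < B)%N &
  forall (M k : nat) (d : 'I_m -> int) y, (0 < M)%N -> (0 < k)%N ->
    (forall j, (`|d j|%N * M < k)%N) -> y *+ k = \sum_j b j *~ d j ->
    `|fnorm y| <= B%:R / M%:R.
Proof.
pose C0 : rat := \sum_j \sum_u \sum_v `|mulmat (b j) u v|.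
have C0_ge0 : 0 <= C0 by do 3!(apply: sumr_ge0 => ? _).
pose C := (Num.truncn C0).+1.
have C0C : C0 <= C%:R by apply/ltW/truncnS_gt.
exists (n`! * C ^ n)%N => [|M k d y M_gt0 k_gt0 dM yE].
  by rewrite muln_gt0 fact_gt0 expn_gt0.
have Mr : 0 < M%:R :> rat by rewrite ltr0n.
have kr : 0 < k%:R :> rat by rewrite ltr0n.
have entry u v : `|mulmat y u v| <= C%:R / M%:R.
  have : mulmat y u v * k%:R = \sum_j mulmat (b j) u v * (d j)%:~R.
    have := congr1 (fun z => mulmat z u v) yE.
    rewrite mulmat_sum raddfMn /= mulmxnE summxE mulr_natr => ->.
    by apply: eq_bigr => j _; rewrite mulrzr mulmxzE.
  move/(congr1 Num.norm); rewrite normrM normr_nat => yk.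
  rewrite ler_pdivlMr // -(ler_pM2r kr) mulrAC yk.
  apply: le_trans (_ : (C0 * k%:R) <= _); last by rewrite ler_pM2r.
  rewrite mulr_suml; apply: le_trans (_ : _ <= (\sum_j `|mulmat (b j) u v * (d j)%:~R|) * M%:R) _.
    by rewrite ler_pM2r // ler_norm_sum.
  rewrite mulr_suml; apply: ler_sum => j _; rewrite normrM -mulrA.
  apply: ler_pM => //; first by rewrite mulr_ge0 // ltW.
    rewrite (bigD1 u) //= (bigD1 v) //= -addrA lerDl addr_ge0 //;
      do ?(apply: sumr_ge0 => ? _) => //.
  by rewrite -intr_norm -natr_absz -natrM ler_nat ltnW.
apply: (le_trans (det_norm_le entry)).
rewrite expr_div_n natrM natrX -mulrA ler_pM2l ?ltr0n ?fact_gt0 //.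
rewrite ler_pM2l; last by rewrite exprn_gt0 // ltr0n.
rewrite lef_pV2 ?posrE ?exprn_gt0 //.
by rewrite -[leLHS]expr1 ler_weXn2l ?ler1n ?adim_gt0.
Qed.

End RegularRepresentation.

Section ProductOfFields.
Variables (K : comNzRingType) (n : nat) (F : 'I_n -> fieldExtType rat).
Variable p : forall i, {rmorphism K -> F i}.
Hypothesis p_inj : forall x y, (forall i, p i x = p i y) -> x = y.
Hypothesis p_surj : forall y : forall i, F i, exists x, forall i, p i x = y i.
Implicit Types (S I : set K) (x y z : K).

Lemma natr_neq0_fieldExt (L : fieldExtType rat) k : (0 < k)%N -> (k%:R : L) != 0.
Proof.
move=> k_gt0; rewrite -(rmorph_nat (in_alg L)) fmorph_eq0 pnatr_eq0.
by case: k k_gt0.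
Qed.

Lemma product_natr_unit k : (0 < k)%N -> exists y : K, k%:R * y = 1.
Proof.
move=> k_gt0; have [y yP] := p_surj (fun i => k%:R^-1).
exists y; apply: p_inj => i.
by rewrite rmorphM rmorph_nat yP rmorph1 divff // natr_neq0_fieldExt.
Qed.

Lemma product_unit x : (forall i, p i x != 0) -> unitK x.
Proof.
move=> x_neq0; have [y yP] := p_surj (fun i => (p i x)^-1).
by exists y; apply: p_inj => i; rewrite rmorphM yP rmorph1 divff ?x_neq0.
Qed.

Definition pnorm x : rat := \prod_i fnorm (p i x).

Lemma pnormM x y : pnorm (x * y) = pnorm x * pnorm y.
Proof. by rewrite -big_split; apply: eq_bigr => i _; rewrite rmorphM fnormM. Qed.

Lemma pnorm1 : pnorm 1 = 1.
Proof. by apply: big1 => i _; rewrite rmorph1; have := @fnorm_nat (F i) 1;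
  rewrite expr1n. Qed.

Lemma pnormX x k : pnorm (x ^+ k) = pnorm x ^+ k.
Proof. by elim: k => [|k IH]; rewrite ?expr0 ?pnorm1 // !exprS pnormM IH. Qed.

Lemma pnorm_unit x : unitK x -> pnorm x != 0.
Proof.
case=> y xy; apply/eqP => x0; have := pnormM x y.
by rewrite xy pnorm1 x0 mul0r => /eqP; rewrite oner_eq0.
Qed.

Lemma pnorm_discrete (A : finType) (b : A -> K) :
  exists2 D : nat, (0 < D)%N & forall x, zspan b x -> pnorm x * D%:R \is a Num.int.
Proof.
have [m [b' ->]] := zspan_ord b.
have /fin_all_exists2 [D D_gt0 DP] i := fnorm_discrete (fun j => p i (b' j)).
exists (\prod_i D i)%N; first exact: prodn_gt0.
move=> _ [c ->]; rewrite natr_prod -big_split; apply: rpred_prod => i _ /=.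
rewrite rmorph_sum /=.
under eq_bigr do rewrite rmorphMz.
exact: DP.
Qed.

(* The pigeonhole principle on the fractional parts of the coordinates of [t * y]. *)
Lemma simultaneous_approximation m (b : 'I_m -> K) (M : nat) y :
  (0 < M)%N -> (exists2 k, (0 < k)%N & zspan b (y *+ k)) ->
  exists t k (w : K) (d : 'I_m -> int),
    [/\ (0 < t <= M ^ m)%N, (0 < k)%N, zspan b w,
        (y *+ t - w) *+ k = \sum_j b j *~ d j
      & forall j, (`|d j|%N * M < k)%N].
Proof.
case: M => // M _ [k k_gt0 [c yk]].
have kz : k%:Z != 0 by case: k k_gt0 {yk}.
pose r (t : nat) j := `|(c j *+ t %% k%:Z)%Z|%N.
have rE t j : (c j *+ t)%R = (c j *+ t %/ k%:Z)%Z * k%:Z + (r t j)%:Z.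
  by rewrite /r gez0_abs ?modz_ge0 // -divz_eq.
have r_lt t j : (r t j < k)%N by rewrite -ltz_nat /r gez0_abs ?modz_ge0 // ltz_mod.
pose box (t : 'I_(M.+1 ^ m).+1) : {ffun 'I_m -> 'I_M.+1} :=
  [ffun j => inord (r t j * M.+1 %/ k)].
have box_lt t j : (r t j * M.+1 %/ k < M.+1)%N by rewrite ltn_divLR // mulnC ltn_pmul2l.
have /injectivePn [t1 [t2 t12 boxE]] : ~~ injectiveb box.
  apply/negP => /injectiveP/leq_card; rewrite card_ffun !card_ord.
  by rewrite ltnn.
have {boxE} boxE j : (r t1 j * M.+1 %/ k = r t2 j * M.+1 %/ k)%N.
  move/ffunP/(_ j): boxE; rewrite !ffunE => /(congr1 val).
  by rewrite /= !inordK.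
wlog lt12 : t1 t2 t12 boxE / (t1 < t2)%N.
  move=> th; case: (ltngtP t1 t2) => [|lt21|/val_inj eq12]; first exact: (th t1 t2).
    by apply: (th t2 t1) => //; rewrite eq_sym.
  by rewrite eq12 eqxx in t12.
exists (t2 - t1)%N, k.
exists (\sum_j b j *~ ((c j *+ t2 %/ k%:Z)%Z - (c j *+ t1 %/ k%:Z)%Z)).
exists (fun j => (r t2 j)%:Z - (r t1 j)%:Z); split=> //.
- by rewrite subn_gt0 lt12 /= (leq_trans (leq_subr _ _)) // -ltnS.
- by eexists.
- rewrite mulrnBl -mulrnA mulnC mulrnA yk -sumrMnl -sumrMnl -sumrB.
  apply: eq_bigr => j _; rewrite !pmulrn -!mulrzA -mulrzBr; congr (_ *~ _).
  have E t : c j * t%:Z = (c j *+ t %/ k%:Z)%Z * k%:Z + (r t j)%:Z.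
    by rewrite -rE pmulrn mulrzz.
  by rewrite -subzn ?(ltnW lt12) // mulrBr !E; ring.
move=> j; have := boxE j.
have := divn_eq (r t1 j * M.+1) k; have := divn_eq (r t2 j * M.+1) k => e2 e1 e.
have := ltn_pmod (r t1 j * M.+1) k_gt0; have := ltn_pmod (r t2 j * M.+1) k_gt0.
rewrite e in e1; move: e1 e2.
move: (r t1 j) (r t2 j) => r1 r2; move: (_ %/ k)%N (_ %% k)%N (_ %% k)%N => q s1 s2.
clear; case: (leqP r1 r2) => r12.
  have -> : `|(r2%:Z - r1%:Z)|%N = (r2 - r1)%N by rewrite distnEl.
  by rewrite mulnBl; lia.
have -> : `|(r2%:Z - r1%:Z)|%N = (r1 - r2)%N by rewrite distnEr // ltnW.
by rewrite mulnBl; lia.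
Qed.

Lemma lattice_uniform_approximation m (b : 'I_m -> K) (m0 : nat) :
  (0 < m0)%N ->
  exists2 M : nat, (0 < M)%N & forall k (d : 'I_m -> int) (g e : K) (Z : {set 'I_n}),
    (0 < k)%N -> (forall j, (`|d j|%N * M < k)%N) -> g *+ k = \sum_j b j *~ d j ->
    (forall i, p i g = 0 <-> i \in Z) ->
    (forall i, p i e = (i \in Z)%:R) -> g != 0 ->
    unitK (g + e *+ m0) /\ `|pnorm (g + e *+ m0)| < 1.
Proof.
move=> m0_gt0.
have /fin_all_exists2 [B B_gt0 BP] i := fnorm_small (fun j => p i (b j)).
pose B' i : nat := (B i + m0 ^ \dim {:F i})%N.
pose M := (\prod_i B' i).+1.
exists M => // k d g e Z k_gt0 dM gk gZ eZ g_neq0.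
have pZ i : i \in Z -> p i (g + e *+ m0) = m0%:R.
  by move=> iZ; rewrite rmorphD rmorphMn /= eZ iZ (iffRL (gZ i) iZ) add0r.
have pnZ i : i \notin Z -> p i (g + e *+ m0) = p i g.
  by move=> iZ; rewrite rmorphD rmorphMn /= eZ (negPf iZ) mul0rn addr0.
split.
  apply: product_unit => i; have [iZ|iZ] := boolP (i \in Z).
    by rewrite pZ // natr_neq0_fieldExt.
  by rewrite pnZ //; apply: contra iZ => /eqP /gZ.
have [i0 i0Z] : exists i, i \notin Z.
  apply/existsP; rewrite -negb_forall; apply: contra g_neq0 => /forallP allZ.
  by apply/eqP/p_inj => i; rewrite rmorph0; apply/gZ.
have M_gt0 : 0 < M%:R :> rat by rewrite ltr0n.
rewrite normr_prod.
apply: le_lt_trans (_ : \prod_i ((B' i)%:R * (if i \in Z then 1 else M%:R^-1)) < 1 :> rat).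
  apply: ler_prod => i _; rewrite normr_ge0 /=; have [iZ|iZ] := boolP (i \in Z).
    rewrite pZ // fnorm_nat -natrX normr_nat mulr1 ler_nat leq_addl //.
  rewrite pnZ //; have pik : p i g *+ k = \sum_j p i (b j) *~ d j.
    by rewrite -rmorphMn gk rmorph_sum; apply: eq_bigr => j _; rewrite rmorphMz.
  apply: (le_trans (BP i M k d _ _ k_gt0 dM pik)) => //.
  by rewrite ler_pM2r ?invr_gt0 // ler_nat leq_addr.
rewrite big_split /= -natr_prod [X in _ * X](bigD1 i0) //= (negPf i0Z) mulrA.
pose q i : rat := if i \in Z then 1 else M%:R^-1.
have rest_le1 : \prod_(i < n | i != i0) q i <= 1.
  suff /andP[] : 0 <= \prod_(i < n | i != i0) q i <= 1 by [].
  apply: (big_ind (fun x : rat => 0 <= x <= 1)); first by rewrite ler01 lexx.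
    by move=> x y /andP[x0 x1] /andP[y0 y1]; rewrite mulr_ge0 // mulr_ile1.
  move=> i _; rewrite /q; case: ifP => _; first by rewrite ler01 lexx.
  by rewrite invr_ge0 ltW // invf_le1 // ler1n.
apply: (le_lt_trans (ler_wpM2l _ rest_le1)).
  by rewrite divr_ge0 // ?ler0n.
by rewrite mulr1 ltr_pdivrMr // mul1r ltr_nat /M.
Qed.

Lemma norm_bounded_index S : is_order S ->
  exists2 c : nat, (0 < c)%N & forall I, submod S I -> I 1 ->
    (forall z, I z -> unitK z -> 1 <= `|pnorm z|) -> forall y, I y -> S (y *+ c).
Proof.
move=> ordS; have [rS latS] := (order_subring ordS, order_lattice ordS).
have gS := subring_zgroup rS.
case: (latS) => -[m [b defS]] full; rewrite -/(zspan b) in defS.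
have idem (Z : {set 'I_n}) : exists e, forall i, p i e = (i \in Z)%:R by exact: p_surj.
have [e eP] : exists e : {set 'I_n} -> K, forall Z i, p i (e Z) = (i \in Z)%:R.
  by have [e eP] := choice idem; exists e.
have [h h_gt0 hP] := fin_all_exists2 (fun Z => full (e Z)).
pose m0 := (\prod_Z h Z)%N.
have m0_gt0 : (0 < m0)%N by apply: prodn_gt0.
have Sm0 Z : S (e Z *+ m0).
  by rewrite /m0 (bigD1 Z) //= mulrnA; apply: zgroupMn.
have [M M_gt0 MP] := lattice_uniform_approximation b m0_gt0.
exists (M ^ m)`!; first exact: fact_gt0.
move=> I [gI SI] I1 normI y Iy.
have SsubI : S `<=` I by apply: submod_sub1.
have yS : exists2 k, (0 < k)%N & zspan b (y *+ k) by rewrite -defS; apply: full.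
have [t [k [w [d [/andP[t_gt0 tM] k_gt0 wS yt dM]]]]] := simultaneous_approximation M_gt0 yS.
rewrite -defS in wS; pose g := y *+ t - w.
have Ig : I g by apply: zgroupB => //; [apply: zgroupMn|apply: SsubI].
have g0 : g = 0.
  apply/eqP/negPn/negP => g_neq0; pose Z := [set i | p i g == 0]%SET.
  have gZ i : p i g = 0 <-> i \in Z by rewrite inE; split=> /eqP.
  have [ug] := MP k d g (e Z) Z k_gt0 dM yt gZ (eP Z) g_neq0.
  rewrite ltNge normI //.
  by apply: zgroupD => //; apply: SsubI.
have /dvdnP [q ->] : (t %| (M ^ m)`!)%N by rewrite dvdn_fact // t_gt0.
rewrite mulnC mulrnA; apply: zgroupMn => //.
by move/eqP: g0; rewrite subr_eq0 => /eqP ->.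
Qed.

End ProductOfFields.

Section Integrality.
Variable K : comNzRingType.
Implicit Types (S I : set K) (x y z : K).

Lemma det_annihilates m (B : 'M[K]_m) (b : 'I_m -> K) :
  (forall i, \sum_j B i j * b j = 0) -> forall i, \det B * b i = 0.
Proof.
move=> Bb i; pose v : 'cV[K]_m := \col_j b j.
have : \adj B *m (B *m v) = 0.
  suff -> : B *m v = 0 by rewrite mulmx0.
  apply/matrixP => k u; rewrite mxE [RHS]mxE -[RHS](Bb k).
  by apply: eq_bigr => j _; rewrite mxE.
rewrite mulmxA mul_adj_mx mul_scalar_mx => /matrixP/(_ i 0).
by rewrite !mxE.
Qed.

Lemma order_integral S : is_order S -> S `<=` @max_order K.
Proof.
move=> ordS s Ss; have [rS [[m [b defS]] _]] := (order_subring ordS, order_lattice ordS).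
rewrite -/(zspan b) in defS.
have Sb i : S (b i) by rewrite defS; apply: zspan_gen.
have sb i : exists c : 'I_m -> int, s * b i = \sum_j b j *~ c j.
  have : S (s * b i) by apply: subringM.
  by rewrite defS.
have [c cP] := choice sb.
pose A : 'M[int]_m := \matrix_(i, j) c i j.
exists (char_poly A); first exact: char_poly_monic.
have -> : map_poly intr (char_poly A) = char_poly (map_mx intr A) :> {poly K}.
  by rewrite -map_char_poly.
have key i : \det (s%:M - map_mx intr A) * b i = 0.
  apply: det_annihilates => k; under eq_bigr do rewrite !mxE mulrBl.
  rewrite sumrB (bigD1 k) //= eqxx mulr1n big1 ?addr0 => [|j /negPf jk].
    apply/eqP; rewrite subr_eq0 cP; apply/eqP; apply: eq_bigr => j _.
    by rewrite mulrzl.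
  by rewrite eq_sym jk mulr0n mul0r.
have -> : root (char_poly (map_mx intr A)) s = (\det (s%:M - map_mx intr A) == 0).
  rewrite rootE /char_poly -horner_evalE -det_map_mx; congr (\det _ == 0).
  apply/matrixP => i j; rewrite !mxE /= /horner_eval.
  by rewrite hornerD hornerN hornerMn hornerX hornerC.
have [d one_span] : zspan b 1 by rewrite -defS; apply: subring1.
rewrite -[\det _]mulr1 [X in _ * X]one_span mulr_sumr; apply/eqP/big1 => j _.
by rewrite mulrzAr key mul0rz.
Qed.

Lemma max_order_subring : subring (@max_order K).
Proof.
split; [split| |].
- exact: (integral0 (intr : {rmorphism int -> K})).
- by move=> x y; apply: (@integral_sub _ _ (intr : {rmorphism int -> K})).
- exact: (integral1 (intr : {rmorphism int -> K})).
by move=> x y; apply: (@integral_mul _ _ (intr : {rmorphism int -> K})).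
Qed.

Lemma integral_powers_span x : max_order x ->
  exists (A : finType) (b : A -> K), forall k, zspan b (x ^+ k).
Proof.
case=> q q_monic /eqP qx; pose m := size q.
pose b (i : 'I_m) : K := x ^+ i; exists 'I_m, b => k.
have gb : zgroup (zspan b) := zspan_zgroup b.
have b_lt i : (i < m)%N -> zspan b (x ^+ i) by move=> lti;
  apply: (zspan_gen b (Ordinal lti)).
have q_gt0 : (0 < m)%N by rewrite /m size_poly_gt0 monic_neq0.
have step : zspan b (x ^+ m).
  have -> : x ^+ m = - \sum_(i < m.-1) x ^+ i.+1 *~ q`_i.
    apply/eqP; rewrite -addr_eq0; apply/eqP.
    rewrite horner_coef size_map_poly_id0 in qx;
      last by rewrite (monicP q_monic) rmorph1 oner_neq0.
    rewrite -/m -(prednK q_gt0) big_ord_recr /= in qx.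
    rewrite !coef_map /= -lead_coefE (monicP q_monic) mul1r in qx.
    rewrite -[RHS](mulr0 x) -[X in _ = x * X]qx mulrDr -exprS prednK // addrC;
      congr (_ + _).
    rewrite mulr_sumr; apply: eq_bigr => i _.
    by rewrite coef_map /= exprS mulrCA mulrzl.
  apply/(zgroupN gb)/(zgroup_sum gb) => i _; apply/(zgroupMz gb)/b_lt.
  by rewrite -ltn_predRL.
have stable y : zspan b y -> zspan b (x * y).
  case=> c ->; rewrite mulr_sumr; apply: (zgroup_sum gb) => i _.
  rewrite mulrzAr /b -exprS; apply: (zgroupMz gb).
  have [lt|] := ltnP i.+1 m; first exact: b_lt.
  by move=> le; have -> : i.+1 = m by apply/eqP; rewrite eqn_leq le ltn_ord.
elim: k => [|k IH]; first exact: b_lt.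
by rewrite exprS; apply: stable.
Qed.

End Integrality.

Section NumberFieldOrders.
Variable K : comNzRingType.
Hypothesis HK : product_of_number_fields K.
Implicit Types (S I J : set K) (x y z : K).

Lemma natr_unit k : (0 < k)%N -> exists y : K, k%:R * y = 1.
Proof. by case: HK => n [F [p [inj surj]]]; apply: (product_natr_unit inj surj). Qed.

Lemma mulrn_eq0_inj k x : (0 < k)%N -> x *+ k = 0 -> x = 0.
Proof.
move=> /natr_unit[y ky] xk.
by rewrite -[x]mul1r -ky -mulrA mulrCA mulr_natl xk mulr0.
Qed.

Definition dilate x I : set K := [set x * y | y in I].

Lemma fractional_ideal_normalized S : is_order S ->
  exists2 c : nat, (0 < c)%N & forall I, fractional_ideal S I ->
    exists x, [/\ unitK x, submod S (dilate x I), S `<=` dilate x I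
                & forall y, dilate x I y -> S (y *+ c)].
Proof.
move=> ordS; case: HK => n [F [p [inj surj]]].
have [c c_gt0 cP] := norm_bounded_index inj surj ordS.
exists c => // I /fractional_idealE[latI [gI SI]].
case: (latI) => -[m [b defI]] full; rewrite -/(zspan b) in defI.
have [D D_gt0 DP] := pnorm_discrete p b; rewrite -defI in DP.
pose P k := `[< exists2 z, I z & unitK z /\ `|pnorm p z| * D%:R = k%:R >].
have normP z : I z -> exists k : nat, `|pnorm p z| * D%:R = k%:R.
  by move=> /DP /natr_norm_int/natrP[k]; rewrite normrM normr_nat; exists k.
have exP : exists k, P k.
  have [k k_gt0 Ik] := full 1; have [v kv] := normP _ Ik.
  by exists v; apply/asboolP; exists (1 *+ k) => //; split=> //; apply: natr_unit.
case: (ex_minnP exP) => v /asboolP[z0 Iz0 [[x z0x] z0v]] vmin.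
have dilP y : dilate x I y <-> I (z0 * y).
  split=> [[w Iw <-]|Iy]; first by rewrite mulrA z0x mul1r.
  by exists (z0 * y); rewrite // mulrA [x * z0]mulrC z0x mul1r.
have subJ : submod S (dilate x I).
  split; last by move=> s y Ss /dilP Iy; apply/dilP; rewrite mulrCA; apply: SI.
  split; first by apply/dilP; rewrite mulr0; apply: zgroup0.
  by move=> y w /dilP Iy /dilP Iw; apply/dilP; rewrite mulrBr; apply: zgroupB.
have J1 : dilate x I 1 by apply/dilP; rewrite mulr1.
exists x; split=> //; [by exists z0; rewrite mulrC|exact: submod_sub1|].
apply: cP => // y /dilP Iy uy.
have uzy : unitK (z0 * y).
  by case: uy => w yw; exists (x * w); rewrite mulrACA z0x yw mulr1.
have [k kE] := normP _ Iy.
have /vmin : P k by apply/asboolP; exists (z0 * y).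
rewrite -(ler_nat rat) -kE -z0v pnormM // normrM mulrAC ler_pMr //.
rewrite mulr_gt0 ?ltr0n // normr_gt0 (@pnorm_unit _ _ _ p) //.
by exists x.
Qed.

Lemma max_order_bounded S : is_order S ->
  exists2 c : nat, (0 < c)%N & forall y, max_order y -> S (y *+ c).
Proof.
move=> ordS; case: HK => n [F [p [inj surj]]].
have [c c_gt0 cP] := norm_bounded_index inj surj ordS; exists c => //.
have rM := max_order_subring K.
apply: (cP (@max_order K)).
- split; first exact: subring_zgroup.
  by move=> s y /(order_integral ordS) ? ?; apply: subringM.
- exact: subring1.
move=> z intz uz; have [A [b zb]] := integral_powers_span intz.
have [D D_gt0 DP] := pnorm_discrete p b.
have normP k : exists v : nat, `|pnorm p z| ^+ k * D%:R == v%:R.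
  have /natr_norm_int/natrP[v] := DP _ (zb k).
  by rewrite normrM normr_nat pnormX // normrX => ->; exists v.
pose P v := `[< exists k, `|pnorm p z| ^+ k * D%:R = v%:R >].
have exP : exists v, P v.
  by have [v /eqP vP] := normP 0%N; exists v; apply/asboolP; exists 0%N.
case: (ex_minnP exP) => v /asboolP[k kv] vmin.
have [w /eqP kw] := normP k.+1.
have /vmin : P w by apply/asboolP; exists k.+1.
rewrite -(ler_nat rat) -kw -kv exprS -mulrA ler_pMl //.
by rewrite mulr_gt0 ?ltr0n // exprn_gt0 // normr_gt0 (@pnorm_unit _ _ _ p).
Qed.

End NumberFieldOrders.

(** * Maximal ideals of orders *)

Section MaximalIdeals.
Variable K : comNzRingType.
Implicit Types (S M P I J : set K) (x y z m t : K).

Section Basics.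
Variables S M : set K.
Hypothesis rS : subring S.

Lemma maximal_idealI : submod S M -> M `<=` S -> ~ M 1 ->
  (forall t, S t -> ~ M t -> exists2 u, S u & M (1 - t * u)) -> maximal_ideal S M.
Proof.
move=> SM MS M1 inv; split; first exact/idealE.
  by move=> E; apply: M1; rewrite E; apply: subring1.
move=> J /idealE[[gJ SJ] JS] MJ;
  have [JM|/existsNP[t /not_implyP[Jt Mt]]] := pselect (J `<=` M).
  by left; apply/seteqP.
right; apply/seteqP; split=> //; apply: submod_sub1 => //.
have [u Su M1tu] := inv t (JS _ Jt) Mt.
rewrite -[1](subrK (t * u)); apply: zgroupD => //; first exact: MJ.
by rewrite mulrC; apply: SJ.
Qed.

Hypothesis maxM : maximal_ideal S M.

Lemma maximal_submod : submod S M. Proof. by case: maxM => /idealE[]. Qed.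
Lemma maximal_zgroup : zgroup M. Proof. by case: maximal_submod. Qed.
Lemma maximal_mul s m : S s -> M m -> M (s * m).
Proof. by case: maximal_submod => _; apply. Qed.
Lemma maximal_sub : M `<=` S. Proof. by case: maxM => /idealE[]. Qed.

Lemma maximal_not1 : ~ M 1.
Proof.
move=> M1; case: maxM => _ + _; apply; apply/seteqP; split; first exact: maximal_sub.
exact: submod_sub1 maximal_submod M1.
Qed.

Lemma maximal_or J : submod S J -> J `<=` S -> M `<=` J -> J `<=` M \/ J 1.
Proof.
move=> SJ JS MJ; case: maxM => _ _ /(_ J) [||->|->]; [exact/idealE|by []|by left|].
by right; apply: subring1.
Qed.

Lemma maximal_inv t : S t -> ~ M t -> exists2 u, S u & M (1 - t * u).
Proof.
move=> St Mt; have gM := maximal_zgroup; have gS := subring_zgroup rS.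
pose J := [set y | exists2 u, S u & M (y - t * u)].
have JI : submod S J.
  split; [split|].
  - by exists 0; [apply: zgroup0|rewrite mulr0 subr0; apply: zgroup0].
  - move=> x y [u Su Mu] [v Sv Mv]; exists (u - v); first exact: zgroupB.
    by rewrite (_ : _ - _ = (x - t * u) - (y - t * v)); [apply: zgroupB|ring].
  move=> s x Ss [u Su Mu]; exists (s * u); first exact: subringM.
  by rewrite (_ : _ - _ = s * (x - t * u)); [apply: maximal_mul|ring].
have [|x Mx|JM|[u Su Mu]] := maximal_or JI; last by exists u.
- move=> x [u Su Mu]; rewrite -[x](subrK (t * u)); apply: zgroupD => //.
    exact: maximal_sub.
  exact: subringM.
- by exists 0; [apply: zgroup0|rewrite mulr0 subr0].
case: Mt; apply: JM; exists 1; first exact: subring1.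
by rewrite mulr1 subrr; apply: zgroup0.
Qed.

Lemma maximal_cancel t m P : zgroup P -> (forall s x, S s -> P x -> P (s * x)) ->
  (forall x, M x -> P (x * m)) -> S t -> ~ M t -> P (t * m) -> P m.
Proof.
move=> gP SP MP St Mt Ptm; have [u Su M1] := maximal_inv St Mt.
have -> : m = u * (t * m) + (1 - t * u) * m by ring.
by apply: zgroupD => //; [apply: SP|apply: MP].
Qed.

Lemma maximal_prime x y : S x -> S y -> M (x * y) -> ~ M x -> M y.
Proof.
move=> Sx Sy Mxy Mx; apply: (@maximal_cancel x y M) => //; first exact: maximal_zgroup.
  by move=> *; apply: maximal_mul.
by move=> z Mz; rewrite mulrC; apply: maximal_mul.
Qed.

Lemma maximal_expr x k : S x -> M (x ^+ k) -> M x.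
Proof.
move=> Sx; elim: k => [|k IH]; first by rewrite expr0 => /maximal_not1.
rewrite exprS => Mx; apply: contrapT => nMx; apply: (nMx); apply: IH.
exact: (maximal_prime Sx (subringX _ rS Sx) Mx nMx).
Qed.

End Basics.

Lemma powers_repeat S c m : is_order S -> (0 < c)%N -> S m ->
  exists a b, (0 < b)%N /\ exists2 z, S z & m ^+ a * (1 - m ^+ b) = z *+ c.
Proof.
move=> ordS c_gt0 Sm; have rS := order_subring ordS; have gS := subring_zgroup rS.
have [rs [rsS rsP]] := lattice_reps (order_lattice ordS) c_gt0.
have /choice [h hP] : forall a : nat, exists i : 'I_(size rs),
    exists2 z, S z & m ^+ a = rs`_i + z *+ c.
  move=> a; have [r /(nthP 0)[i lti <-] zP] := rsP _ (subringX a rS Sm).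
  by exists (Ordinal lti).
have /injectivePn [a [b ab hab]] : ~~ injectiveb (fun a : 'I_(size rs).+1 => h a).
  by apply/negP => /injectiveP/leq_card; rewrite !card_ord ltnn.
wlog ltab : a b ab hab / (a < b)%N.
  move=> th; case: (ltngtP a b) => [|ltba|/val_inj eqab]; first exact: (th a b).
    by apply: (th b a) => //; rewrite eq_sym.
  by rewrite eqab eqxx in ab.
have [z Sz za] := hP a; have [w Sw wb] := hP b.
exists a, (b - a)%N; split; first by rewrite subn_gt0.
exists (z - w); first exact: zgroupB.
rewrite mulrBr mulr1 -exprD subnKC ?(ltnW ltab) // za wb hab mulrnBl; ring.
Qed.

(* A module over an order with a nonzero finite quotient at [M] has a socle
   element there.  Killing one [m] of [M] at a time: some power of [m] sends
   the current element into [P] after multiplication by an [s] outside [M],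
   and the last power that does not is the next element. *)
Lemma socle S M P y c : is_order S -> maximal_ideal S M -> submod S P ->
  (0 < c)%N -> P (y *+ c) -> (forall t, S t -> P (t * y) -> M t) ->
  exists t, [/\ S t, ~ P (t * y) & forall m, M m -> P (m * (t * y))].
Proof.
move=> ordS maxM [gP SP] c_gt0 Pcy annM; have rS := order_subring ordS.
have gS := subring_zgroup rS; have gM := maximal_zgroup maxM.
have MS := maximal_sub maxM; have M1 := maximal_not1 maxM.
have Pcs s : S s -> P (s * y *+ c) by move=> Ss; rewrite -mulrnAr; apply: SP.
have Mc s : S s -> M (s *+ c).
  by move=> Ss; apply: annM; [apply: zgroupMn|rewrite mulrnAl; apply: Pcs].
have [rs [rsS rsP]] := lattice_reps (order_lattice ordS) c_gt0.
have key (ms : seq K) : exists t, [/\ S t, forall u, S u -> P (u * (t * y)) -> M u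
    & forall m, m \in ms -> M m -> P (m * (t * y))].
  elim: ms => [|m ms [t [St tM tP]]].
    by exists 1; split=> //; [apply: subring1|move=> u Su; rewrite mul1r; apply: annM].
  have [Mm|nMm] := pselect (M m); last first.
    by exists t; split=> // m'; rewrite inE => /predU1P[->|/tP].
  have [a [b [b_gt0 [z Sz mab]]]] := powers_repeat ordS c_gt0 (MS _ Mm).
  pose Q j := `[< exists2 s, S s /\ ~ M s & P (s * m ^+ j * (t * y)) >].
  have exQ : exists j, Q j.
    exists a; apply/asboolP; exists (1 - m ^+ b).
      have Mmb : M (m ^+ b).
        rewrite -(prednK b_gt0) exprSr; apply: (maximal_mul maxM) => //.
        by apply: subringX => //; apply: MS.
      split; first by apply: zgroupB => //; [apply: subring1|apply: MS].
      by move=> M1b; apply: M1; rewrite -[1](subrK (m ^+ b)); apply: zgroupD.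
    rewrite [_ * m ^+ a]mulrC mab mulrA mulrnAl mulrnAl; apply: Pcs.
    exact: subringM.
  case: (ex_minnP exQ) => -[|j] /asboolP[s [Ss nMs] Ps] jmin.
    by case: nMs; apply: tM => //; rewrite -[s]mulr1 -[1](expr0 m).
  have Smj : S (m ^+ j) by apply: subringX => //; apply: MS.
  exists (s * m ^+ j * t); split.
  - by do 2!apply: subringM => //.
  - move=> u Su Pu; apply: contrapT => nMu.
    suff /jmin : Q j by rewrite ltnn.
    apply/asboolP; exists (u * s); last by move: Pu; rewrite !mulrA.
    by split; [apply: subringM|move/(maximal_prime rS maxM Su Ss)/(_ nMu)].
  move=> m'; rewrite inE => /predU1P[-> _|m'ms Mm'].
    by move: Ps; rewrite exprS; congr P; ring.
  rewrite (_ : _ * _ = s * m ^+ j * (m' * (t * y))); last ring.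
  by apply: SP; [apply: subringM|apply: tP].
have [t [St tM tP]] := key rs; exists t; split=> // [Pty|m Mm].
  by apply: M1; apply: tM; [apply: subring1|rewrite mul1r].
have [r r_rs [z Sz mE]] := rsP _ (MS _ Mm).
have Mr : M r by have := zgroupB gM Mm (Mc z Sz); rewrite mE addrK.
rewrite mE mulrDl; apply: zgroupD => //; first exact: tP.
by rewrite mulrnAl mulrA; apply: Pcs; apply: subringM.
Qed.

(* An integral [x] with [x M] inside [S] satisfies [x M] inside [M]: otherwise
   [x m] is congruent to a unit for some [m] in [M], and multiplying the integral
   equation of [x] by a power of [m] gives a contradiction. *)
Lemma integral_colon S M x : subring S -> maximal_ideal S M -> max_order x ->
  (forall m, M m -> S (x * m)) -> forall m, M m -> M (x * m).
Proof.
move=> rS maxM [q q_monic /eqP qx] xMS m Mm; have gM := maximal_zgroup maxM.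
have gS := subring_zgroup rS; have MS := maximal_sub maxM.
set w := x * m; have Sw : S w by apply: xMS.
pose e := (size q).-1.
have q_gt0 : (0 < size q)%N by rewrite size_poly_gt0 monic_neq0.
suff Mwe : M (w ^+ e) by apply: (maximal_expr rS maxM Sw Mwe).
have -> : w ^+ e = - \sum_(j < e) (w ^+ j * m ^+ (e - j).-1 * m) *~ q`_j.
  apply/eqP; rewrite -addr_eq0; apply/eqP.
  rewrite horner_coef size_map_poly_id0 in qx; last first.
    by rewrite (monicP q_monic) rmorph1 oner_neq0.
  rewrite -(prednK q_gt0) big_ord_recr /= in qx.
  rewrite !coef_map /= -lead_coefE (monicP q_monic) mul1r -/e in qx.
  rewrite -[RHS](mulr0 (m ^+ e)) -[X in _ = _ * X]qx mulrDr addrC; congr (_ + _).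
    rewrite mulr_sumr; apply: eq_bigr => j _; rewrite coef_map /= mulrCA mulrzl.
    congr (_ *~ _); rewrite -mulrA -exprSr prednK ?subn_gt0 // exprMn.
    have -> : m ^+ e = m ^+ j * m ^+ (e - j) by rewrite -exprD subnKC // ltnW.
    by ring.
  by rewrite exprMn mulrC.
apply/(zgroupN gM)/(zgroup_sum gM) => j _; apply/(zgroupMz gM).
apply: (maximal_mul maxM) => //; apply: subringM => //; first exact: subringX.
by apply: subringX => //; apply: MS.
Qed.

Hypothesis HK : product_of_number_fields K.

Lemma singular_multiplier S M : is_order S -> singular_maximal_ideal S M ->
  exists2 x, ~ S x & forall m, M m -> M (x * m).
Proof.
move=> ordS [maxM fM]; have rS := order_subring ordS.
have gS := subring_zgroup rS; have gM := maximal_zgroup maxM.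
have M1 := maximal_not1 maxM.
have SB := order_integral ordS; have rB := max_order_subring K.
have [c c_gt0 cB] := max_order_bounded HK ordS.
have [rs [rsS rsP]] := lattice_reps (order_lattice ordS) c_gt0.
have [y By yM] : exists2 y, max_order y & forall t, S t -> S (t * y) -> M t.
  apply: contrapT => nex.
  have out y : max_order y -> exists2 t, S t /\ ~ M t & S (t * y).
    move=> By; apply: contrapT => nt; apply: nex; exists y => // t St Sty.
    by apply: contrapT => nMt; apply: nt; exists t.
  have [s [Ss nMs sP]] : exists s, [/\ S s, ~ M s & forall y, max_order y ->
      (exists2 r, r \in rs & exists2 z, S z & y *+ c = r + z *+ c) -> S (s * y)].
    elim: rs {rsS rsP} => [|r rs [s [Ss nMs sP]]].
      by exists 1; split=> //; [apply: subring1|move=> y _ []].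
    have [[y0 By0 [z0 Sz0 y0E]]|nr] := pselect (exists2 y, max_order y &
        exists2 z, S z & y *+ c = r + z *+ c).
      have [t [St nMt] Sty] := out y0 By0.
      exists (s * t); split; first exact: subringM.
        by move/(maximal_prime rS maxM Ss St)/(_ nMs).
      move=> y By [r']; rewrite inE => /predU1P[->|r'rs] [z Sz yE].
        have -> : y = y0 + (z - z0).
          apply/eqP; rewrite -subr_eq0; apply/eqP/(mulrn_eq0_inj HK c_gt0).
          by rewrite mulrnBl mulrnDl yE y0E mulrnBl; ring.
        rewrite mulrDr; apply: zgroupD => //; first by rewrite -mulrA; apply: subringM.
        by apply: subringM; [|apply: subringM|apply: zgroupB].
      by rewrite mulrAC [_ * t]mulrC; apply: subringM => //; apply: sP => //;
        exists r' => //; exists z.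
    exists s; split=> // y By [r']; rewrite inE => /predU1P[->|r'rs] [z Sz yE].
      by case: nr; exists y => //; exists z.
    by apply: sP => //; exists r' => //; exists z.
  apply: nMs; apply: fM => y By; apply: sP => //.
  by apply: rsP; apply: cB.
have [t [St nSty tyM]] := socle ordS maxM (subring_submod rS) c_gt0 (cB y By) yM.
exists (t * y) => // m Mm.
apply: (integral_colon rS maxM) => //.
  by apply: (subringM rB) => //; apply: SB.
by move=> m' /tyM; rewrite mulrC.
Qed.

Lemma singular_nat_mem S M : is_order S -> singular_maximal_ideal S M ->
  exists2 c : nat, (0 < c)%N & M c%:R.
Proof.
move=> ordS [_ fM]; have [c c_gt0 cB] := max_order_bounded HK ordS.
by exists c => //; apply: fM => y By; rewrite mulr_natl; apply: cB.
Qed.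

End MaximalIdeals.

(** * The class groups of an order and an overorder *)

Section InvertibleIdeals.
Variable K : comNzRingType.
Implicit Types (S T M I J A B : set K) (x y z : K).

Lemma dilate1 I : dilate 1 I = I.
Proof.
by apply/seteqP; split=> [_ [y Iy <-]|y Iy]; rewrite ?mul1r //; exists y; rewrite ?mul1r.
Qed.

Lemma dilateM x y I : dilate (x * y) I = dilate x (dilate y I).
Proof.
apply/seteqP; split=> [_ [z Iz <-]|_ [_ [w Iw <-] <-]].
  by exists (y * z); [exists z|rewrite mulrA].
by exists w; rewrite // mulrA.
Qed.

Lemma dilate_zgroup x I : zgroup I -> zgroup (dilate x I).
Proof.
move=> gI; split; first by exists 0; [apply: zgroup0|rewrite mulr0].
by move=> _ _ [y Iy <-] [z Iz <-]; exists (y - z); [apply: zgroupB|rewrite mulrBr].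
Qed.

Lemma dilate_submod S x I : submod S I -> submod S (dilate x I).
Proof.
move=> [gI SI]; split; first exact: dilate_zgroup.
by move=> s _ Ss [y Iy <-]; exists (s * y); [apply: SI|rewrite mulrCA].
Qed.

Lemma dilate_lattice x I : unitK x -> lattice I -> lattice (dilate x I).
Proof.
case=> y xy [[n [b defI]] full]; rewrite -/(zspan b) in defI.
have -> : dilate x I = zspan (fun i => x * b i).
  rewrite defI; apply/seteqP; split=> [_ [_ [c ->] <-]|_ [c ->]].
    by exists c; rewrite mulr_sumr; apply: eq_bigr => i _; rewrite mulrzAr.
  exists (\sum_i b i *~ c i); first by exists c.
  by rewrite mulr_sumr; apply: eq_bigr => i _; rewrite mulrzAr.
apply: zspan_lattice => z; have [k k_gt0 Ik] := full (y * z); exists k => //.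
have -> : z *+ k = x * (y * z *+ k) by rewrite mulrnAr mulrA xy mul1r.
move: Ik; rewrite defI => -[c ->]; exists c.
by rewrite mulr_sumr; apply: eq_bigr => i _; rewrite mulrzAr.
Qed.

Lemma dilate_prod x I J : set_prod (dilate x I) J = dilate x (set_prod I J).
Proof.
apply/seteqP; split.
  apply: (@set_prod_ind _ _ _ (dilate x (set_prod I J))).
  - by exists 0; [apply: set_prod0|rewrite mulr0].
  - by move=> _ _ [y Iy <-] [z Iz <-]; exists (y + z); [apply: set_prodD|rewrite mulrDr].
  by move=> _ b [a Ia <-] Jb; exists (a * b); [apply: set_prodM|rewrite mulrA].
move=> _ [y IJy <-]; move: y IJy; apply: set_prod_ind.
- by rewrite mulr0; apply: set_prod0.
- by move=> y z ? ?; rewrite mulrDr; apply: set_prodD.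
by move=> a b Ia Jb; rewrite mulrA; apply: set_prodM => //; exists a.
Qed.

Lemma set_prod_lattice I J : lattice I -> lattice J -> lattice (set_prod I J).
Proof.
move=> [[n [b defI]] fullI] [[m [d defJ]] fullJ].
rewrite -/(zspan b) in defI; rewrite -/(zspan d) in defJ.
pose g (u : 'I_n * 'I_m) := b u.1 * d u.2.
have gg := zspan_zgroup g.
have eqg : set_prod I J = zspan g.
  apply/seteqP; split; last first.
    apply: zspan_sub => [|[i j]].
      by apply: set_prod_zgroup; rewrite defI; apply: zspan_zgroup.
    by apply: set_prodM; rewrite ?defI ?defJ; apply: zspan_gen.
  apply: set_prod_sub => // x y; rewrite defI defJ => -[c ->] [e ->].
  rewrite mulr_suml; apply: (zgroup_sum gg) => i _.
  rewrite mulr_sumr; apply: (zgroup_sum gg) => j _.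
  rewrite mulrzAr mulrzAl; do 2!apply: (zgroupMz gg).
  exact: (zspan_gen g (i, j)).
rewrite eqg; apply: zspan_lattice => x; rewrite -eqg.
have [k k_gt0 Ik] := fullI x; have [l l_gt0 Jl] := fullJ 1.
exists (k * l)%N; first by rewrite muln_gt0 k_gt0.
by rewrite mulrnA -[x *+ k]mulr1 -mulrnAr; apply: set_prodM.
Qed.

Section Invertible.
Variable S : set K.
Hypothesis ordS : is_order S.
Let rS := order_subring ordS.

Lemma order_prod_id : set_prod S S = S.
Proof. exact: set_prod_idl (subring_submod rS) (subring1 rS). Qed.

Lemma invertible_submod I : invertible_ideals S I -> submod S I.
Proof. by case=> /fractional_idealE[]. Qed.

Lemma invertible_mulr I : invertible_ideals S I -> set_prod I S = I.
Proof. by move/invertible_submod/set_prod_idl; apply; apply: subring1. Qed.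

Lemma order_invertible : invertible_ideals S S.
Proof.
have fS : fractional_ideal S S.
  by apply/fractional_idealE; split; [apply: order_lattice|apply: subring_submod].
by split=> //; exists S => //; apply: order_prod_id.
Qed.

Lemma invertible_prod I J :
  invertible_ideals S I -> invertible_ideals S J -> invertible_ideals S (set_prod I J).
Proof.
move=> [/fractional_idealE[lI mI] [I' /fractional_idealE[lI' mI'] II']].
move=> [/fractional_idealE[lJ mJ] [J' /fractional_idealE[lJ' mJ'] JJ']].
split; first by apply/fractional_idealE; split;
  [apply: set_prod_lattice|apply: set_prod_submod].
exists (set_prod I' J').
  by apply/fractional_idealE; split; [apply: set_prod_lattice|apply: set_prod_submod].
by rewrite set_prodACA II' JJ' order_prod_id.
Qed.

Lemma invertible_inverse I : invertible_ideals S I ->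
  exists2 J, invertible_ideals S J & set_prod I J = S.
Proof. by move=> [fI [J fJ IJ]]; exists J => //; split=> //; exists I;
  rewrite // set_prodC. Qed.

Lemma invertible_dilate x I :
  unitK x -> invertible_ideals S I -> invertible_ideals S (dilate x I).
Proof.
move=> ux [/fractional_idealE[lI mI] [J /fractional_idealE[lJ mJ] IJ]].
split; first by apply/fractional_idealE; split;
  [apply: dilate_lattice|apply: dilate_submod].
case: (ux) => y xy; exists (dilate y J).
  apply/fractional_idealE; split; last exact: dilate_submod.
  by apply: dilate_lattice => //; exists x; rewrite mulrC.
by rewrite dilate_prod set_prodC dilate_prod -dilateM xy dilate1 set_prodC.
Qed.

Definition ideal_class I : set (set K) := [set set_prod I P | P in principal_ideals S].

Lemma class_numberE : class_number S = ncard (ideal_class @` invertible_ideals S).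
Proof. by []. Qed.

Lemma set_prod_principal I x : submod S I -> set_prod I (dilate x S) = dilate x I.
Proof.
by move=> mI; rewrite set_prodC dilate_prod set_prodC set_prod_idl //; apply: subring1.
Qed.

Lemma ideal_class_eq I J : submod S I -> submod S J ->
  (ideal_class I = ideal_class J <-> exists2 x, unitK x & J = dilate x I).
Proof.
move=> mI mJ; split.
  move=> clIJ; have : ideal_class I I.
    exists (dilate 1 S); last by rewrite set_prod_principal // dilate1.
    by exists 1; split=> //; exists 1; rewrite mulr1.
  rewrite clIJ => -[_ [x [[y xy] ->]]];
    rewrite -/(dilate x S) set_prod_principal // => <-.
  by exists y; [exists x; rewrite mulrC|rewrite -dilateM mulrC xy dilate1].
case=> x [y xy] ->; apply/seteqP; split=> _ [_ [z [[w zw] ->]] <-].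
  exists (dilate (z * y) S).
    by exists (z * y); split=> //; exists (x * w);
      rewrite -mulrA [y * _]mulrA [y * x]mulrC xy mul1r zw.
  rewrite -/(dilate z S) !set_prod_principal //; last exact: dilate_submod.
  by rewrite -dilateM -mulrA [y * x]mulrC xy mulr1.
exists (dilate (z * x) S).
  by exists (z * x); split=> //; exists (y * w); rewrite -mulrA [x * _]mulrA xy mul1r zw.
rewrite -/(dilate z S) !set_prod_principal //; last exact: dilate_submod.
by rewrite -dilateM.
Qed.

End Invertible.

Section ClassGroupFinite.
Hypothesis HK : product_of_number_fields K.

Lemma finite_ideal_classes S : is_order S ->
  finite_set (ideal_class S @` invertible_ideals S).
Proof.
move=> ordS; have rS := order_subring ordS; have gS := subring_zgroup rS.
have [c c_gt0 cP] := fractional_ideal_normalized HK ordS.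
have [y cy] := natr_unit HK c_gt0.
have uy : unitK y by exists c%:R; rewrite mulrC.
have latL : lattice (dilate y S) by apply: dilate_lattice => //; apply: order_lattice.
have fin := finite_intermediate_groups latL c_gt0.
apply: sub_finite_set (finite_image (ideal_class S) fin) => _ [I invI <-].
have [x [ux mJ SJ JS]] := cP I (proj1 invI).
exists (dilate x I).
  split; first by case: mJ.
    move=> z Jz; exists (z *+ c); first exact: JS.
    by rewrite mulrnAr -mulr_natl mulrA cy mul1r.
  move=> _ [s Ss <-]; apply: SJ.
  by rewrite mulrC -mulrnAr -mulr_natl cy mulr1.
apply/esym/(ideal_class_eq ordS) => //; last by exists x.
exact: (invertible_submod invI).
Qed.

End ClassGroupFinite.

Section ExactSequence.
Hypothesis HK : product_of_number_fields K.
Variables T S M : set K.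
Hypotheses (ordT : is_order T) (ordS : is_order S) (TS : T `<=` S).
Hypothesis maxM : maximal_ideal T M.
Hypothesis SM : submod S M.
Hypothesis natM : exists2 c : nat, (0 < c)%N & M c%:R.
Hypothesis primitive : forall A B, submod S A -> submod S B -> set_prod A B = S ->
  exists a b, [/\ A a, B b & M (1 - a * b)].

Let rT := order_subring ordT.
Let rS := order_subring ordS.
Let gT := subring_zgroup rT.
Let gS := subring_zgroup rS.
Let gM := maximal_zgroup maxM.
Let MT := maximal_sub maxM.
Let M1 := maximal_not1 maxM.

Definition line A a : set K := [set y | exists2 t, T t & set_prod M A (y - a * t)].

Definition unit_mod s := S s /\ exists2 s', S s' & M (1 - s * s').

Lemma submod_restrict I : submod S I -> submod T I.
Proof. by move=> [gI SI]; split=> // s x /TS; apply: SI. Qed.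

Lemma MS_id : set_prod M S = M.
Proof. exact: set_prod_idl SM (subring1 rS). Qed.

Lemma extension_prod : set_prod T S = S.
Proof.
by rewrite set_prodC set_prod_idl //; [apply: submod_restrict;
  apply: subring_submod|apply: subring1].
Qed.

Lemma extension_invertible I : invertible_ideals T I -> invertible_ideals S (set_prod I S).
Proof.
move=> [/fractional_idealE[lI mI] [J /fractional_idealE[lJ mJ] IJ]].
have lS := order_lattice ordS; have mS := subring_submod rS.
split.
  by apply/fractional_idealE; split; [apply: set_prod_lattice|rewrite set_prodC;
    apply: set_prod_submod].
exists (set_prod J S).
  by apply/fractional_idealE; split; [apply: set_prod_lattice|rewrite set_prodC;
    apply: set_prod_submod].
by rewrite set_prodACA IJ order_prod_id // extension_prod.
Qed.

Lemma extension_mul I J :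
  set_prod (set_prod I S) (set_prod J S) = set_prod (set_prod I J) S.
Proof. by rewrite set_prodACA order_prod_id. Qed.

Lemma maximal_prod_sub A : submod S A -> set_prod M A `<=` A.
Proof. by move=> [gA SA]; apply: set_prod_sub => // m y /MT/TS; apply: (SA). Qed.

(* With [a b] congruent to [1] modulo [M], the lattices [a T + M A] and
   [b T + M B] are inverse to each other over [T]. *)
Lemma line_prod A B a b : submod S A -> submod S B -> set_prod A B = S ->
  A a -> B b -> M (1 - a * b) -> set_prod (line A a) (line B b) = T.
Proof.
move=> mA mB AB Aa Bb M1ab.
have MAB : set_prod (set_prod M A) B = M by rewrite -set_prodA AB MS_id.
have MAB' x y : set_prod M A x -> B y -> M (x * y).
  by move=> Mx By; rewrite -MAB; apply: set_prodM.
have MBA' x y : set_prod M B x -> A y -> M (x * y).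
  by move=> Mx Ay; rewrite -MAB -set_prodA (set_prodC A) set_prodA; apply: set_prodM.
have gMA : zgroup (set_prod M A) by apply: set_prod_zgroup.
have gMB : zgroup (set_prod M B) by apply: set_prod_zgroup.
have MB_B := maximal_prod_sub mB.
have Tab : T (a * b).
  by rewrite (_ : a * b = 1 - (1 - a * b)); [apply: zgroupB => //;
    [apply: subring1|apply: MT]|ring].
apply/seteqP; split.
  apply: set_prod_sub => // x y [t Tt xt] [u Tu yu].
  have -> : x * y = (x - a * t) * (b * u) + (x - a * t) * (y - b * u)
      + a * b * (t * u) + (y - b * u) * (a * t) by ring.
  have Bbu : B (b * u) by case: mB => _ SB; rewrite mulrC; apply: (SB) => //; apply: TS.
  have Aat : A (a * t) by case: mA => _ SA; rewrite mulrC; apply: (SA) => //; apply: TS.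
  apply: zgroupD => //; last by apply/MT/MBA'.
  apply: zgroupD => //; last by apply: subringM => //; apply: subringM.
  by apply: zgroupD => //; apply/MT/MAB' => //; apply: MB_B.
have gL : zgroup (set_prod (line A a) (line B b)).
  apply: set_prod_zgroup; split.
    by exists 0; [apply: zgroup0|rewrite mulr0 subr0; apply: zgroup0].
  move=> x y [t Tt xt] [u Tu yu]; exists (t - u); first exact: zgroupB.
  by rewrite (_ : _ - _ = (x - a * t) - (y - a * u)); [apply: zgroupB|ring].
have lineMA x : set_prod M A x -> line A a x.
  by move=> Mx; exists 0; [apply: zgroup0|rewrite mulr0 subr0].
have lineMB x : set_prod M B x -> line B b x.
  by move=> Mx; exists 0; [apply: zgroup0|rewrite mulr0 subr0].
have line_a t : T t -> line A a (a * t).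
  by move=> Tt; exists t => //; rewrite subrr; apply: zgroup0.
have line_b : line B b b.
  by exists 1; [apply: subring1|rewrite mulr1 subrr; apply: zgroup0].
have Mm m : M m -> set_prod (line A a) (line B b) m.
  move=> Mm; have -> : m = a * 1 * (m * b) + (1 - a * b) * m by ring.
  apply: zgroupD => //.
    apply: set_prodM; first by apply: line_a; apply: subring1.
    by apply: lineMB; apply: set_prodM.
  have [n [u [v [uv oneE]]]] : set_prod A B 1 by rewrite AB; apply: subring1.
  rewrite -[_ * m]mulr1 [X in _ * X]oneE mulr_sumr; apply: (zgroup_sum gL) => i _.
  have [Au Bv] := uv i; rewrite mulrACA; apply: set_prodM.
    by apply: lineMA; apply: set_prodM.
  by apply: lineMB; apply: set_prodM.
move=> t Tt; rewrite (_ : t = a * t * b + (1 - a * b) * t); last by ring.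
apply: zgroupD => //; first by apply: set_prodM => //; apply: line_a.
by apply: Mm; rewrite mulrC; apply: (maximal_mul maxM).
Qed.

Lemma line_fractional A a : submod S A -> lattice A -> A a -> fractional_ideal T (line A a).
Proof.
move=> mA lA Aa; case: (mA) => gA SA.
have gMA : zgroup (set_prod M A) by apply: set_prod_zgroup.
have gL : zgroup (line A a).
  split; first by exists 0; [apply: zgroup0|rewrite mulr0 subr0; apply: zgroup0].
  move=> x y [t Tt xt] [u Tu yu]; exists (t - u); first exact: zgroupB.
  by rewrite (_ : _ - _ = (x - a * t) - (y - a * u)); [apply: zgroupB|ring].
apply/fractional_idealE; split; last first.
  split=> // s x Ts [t Tt xt]; exists (s * t); first exact: subringM.
  rewrite (_ : _ - _ = s * (x - a * t)); last by ring.
  by have [_] := set_prod_submod A SM; apply => //; apply: TS.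
have [c c_gt0 Mc] := natM.
apply: sublattice lA c_gt0 gL _ _ => [x [t Tt xt]|x Ax].
  rewrite -[x](subrK (a * t)); apply: zgroupD => //; last first.
    by rewrite mulrC; apply: (SA) => //; apply: TS.
  exact: (maximal_prod_sub mA).
exists 0; first exact: zgroup0.
by rewrite mulr0 subr0 -mulr_natl; apply: set_prodM.
Qed.

Lemma line_extension A a b B : submod S A -> submod S B -> set_prod A B = S ->
  A a -> B b -> M (1 - a * b) -> set_prod (line A a) S = A.
Proof.
move=> mA mB AB Aa Bb M1ab; case: (mA) => gA SA.
have gMA : zgroup (set_prod M A) by apply: set_prod_zgroup.
apply/seteqP; split.
  apply: set_prod_sub => // x s [t Tt xt] Ss; rewrite mulrC; apply: (SA) => //.
  rewrite -[x](subrK (a * t)); apply: zgroupD => //; last first.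
    by rewrite mulrC; apply: (SA) => //; apply: TS.
  exact: (maximal_prod_sub mA).
move=> y Ay; have -> : y = a * (b * y) + (1 - a * b) * y * 1 by ring.
apply: set_prodD; apply: set_prodM.
- exists 1; first exact: subring1.
  by rewrite mulr1 subrr; apply: zgroup0.
- by rewrite -AB mulrC; apply: set_prodM.
- exists 0; first exact: zgroup0.
  by rewrite mulr0 subr0; apply: set_prodM.
exact: subring1.
Qed.

Lemma line_invertible A B a b : submod S A -> submod S B -> lattice A -> lattice B ->
  set_prod A B = S -> A a -> B b -> M (1 - a * b) -> invertible_ideals T (line A a).
Proof.
move=> mA mB lA lB AB Aa Bb M1ab; split; first exact: line_fractional.
by exists (line B b); [apply: line_fractional|apply: line_prod].
Qed.

Lemma extension_surjective A : invertible_ideals S A ->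
  exists2 I, invertible_ideals T I & set_prod I S = A.
Proof.
move=> [/fractional_idealE[lA mA] [B /fractional_idealE[lB mB] AB]].
have [a [b [Aa Bb Mab]]] := primitive mA mB AB.
exists (line A a); first exact: (line_invertible mA mB lA lB AB Aa Bb Mab).
exact: (line_extension mA mB AB Aa Bb Mab).
Qed.

Definition extension_kernel : set (set K) :=
  [set I | invertible_ideals T I /\ set_prod I S = S].

Lemma extension_kernelP I :
  extension_kernel I <-> exists2 s, unit_mod s & I = line S s.
Proof.
split=> [[invI IS]|[s [Ss [s' Ss' Ms]] ->]]; last first.
  have [lS mS] := (order_lattice ordS, subring_submod rS).
  have SS := order_prod_id ordS.
  split; first exact: (line_invertible mS mS lS lS SS Ss Ss' Ms).
  exact: (line_extension mS mS SS Ss Ss' Ms).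
have [J invJ IJ] := invertible_inverse invI.
have JS : set_prod J S = S.
  by rewrite -[RHS]extension_prod -IJ -extension_mul IS [RHS]set_prodC -set_prodA order_prod_id.
have IsubS : I `<=` S.
  by rewrite -IS => x Ix; rewrite -[x]mulr1; apply: set_prodM => //; apply: subring1.
have JsubS : J `<=` S.
  by rewrite -JS => x Jx; rewrite -[x]mulr1; apply: set_prodM => //; apply: subring1.
have [gI TI] := invertible_submod invI.
have [a [b [Ia Jb nMab]]] : exists a b, [/\ I a, J b & ~ M (a * b)].
  apply: contrapT => nex; apply: M1.
  suff : set_prod I J `<=` M by apply; rewrite IJ; apply: subring1.
  apply: set_prod_sub => // a b Ia Jb; apply: contrapT => nMab.
  by apply: nex; exists a, b.
have Tab : T (a * b) by rewrite -IJ; apply: set_prodM.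
have [u Tu Mu] := maximal_inv rT maxM Tab nMab.
exists a.
  split; first exact: IsubS.
  exists (b * u); last by rewrite mulrA.
  by apply: subringM => //; [apply: JsubS|apply: TS].
have MI m : M m -> I m.
  move=> Mm; rewrite -[m]mulr1.
  have : set_prod I S 1 by rewrite IS; apply: subring1.
  move: 1; apply: set_prod_ind; first by rewrite mulr0; apply: zgroup0.
    by move=> x y ? ?; rewrite mulrDr; apply: zgroupD.
  move=> i s Ii Ss; rewrite mulrCA mulrC; apply: (TI) => //; apply: MT.
  by rewrite mulrC; case: SM => _; apply.
rewrite /line MS_id; apply/seteqP; split=> [y Iy|y [t Tt Mt]].
  exists (y * b * u); first by apply: subringM => //; rewrite -IJ; apply: set_prodM.
  rewrite (_ : _ - _ = y * (1 - a * b * u)); last by ring.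
  by case: SM => _; apply => //; apply: IsubS.
rewrite -[y](subrK (a * t)); apply: zgroupD => //; first exact: MI.
by rewrite mulrC; apply: (TI).
Qed.

Lemma line_eq s s' : unit_mod s -> unit_mod s' ->
  (line S s = line S s' <-> exists2 t, T t /\ ~ M t & M (s' - s * t)).
Proof.
move=> [Ss [v Sv Mv]] [Ss' [v' Sv' Mv']]; rewrite /line MS_id.
have SMm x m : S x -> M m -> M (x * m) by case: SM => _; apply.
split.
  move=> eqL; have : [set y | exists2 t, T t & M (y - s' * t)] s'.
    by exists 1; [apply: subring1|rewrite mulr1 subrr; apply: zgroup0].
  rewrite -eqL => -[t Tt Mt]; exists t => //; split=> // nMt; apply: M1.
  rewrite (_ : 1 = (1 - s' * v') + v' * (s' - s * t) + v' * s * t); last by ring.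
  apply: zgroupD => //; last by apply: (SMm) => //; apply: subringM.
  by apply: zgroupD => //; apply: (SMm).
have half r r' : S r -> S r' -> (exists2 t, T t /\ ~ M t & M (r' - r * t)) ->
    [set y | exists2 t, T t & M (y - r' * t)] `<=` [set y | exists2 t, T t & M (y - r * t)].
  move=> Sr Sr' [t [Tt nMt] Mt] y [u Tu Mu]; exists (t * u); first exact: subringM.
  rewrite (_ : _ - _ = (y - r' * u) + u * (r' - r * t)); last by ring.
  by apply: zgroupD => //; apply: (SMm) => //; apply: TS.
move=> ex; apply/seteqP; split; last exact: half.
apply: half => //; case: ex => t [Tt nMt] Mt.
have [u Tu Mu] := maximal_inv rT maxM Tt nMt.
exists u.
  split=> // MU; apply: M1; rewrite -[1](subrK (t * u)); apply: zgroupD => //.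
  exact: (maximal_mul maxM).
rewrite (_ : _ - _ = s * (1 - t * u) + - u * (s' - s * t)); last by ring.
apply: zgroupD => //; first exact: SMm.
by apply: (SMm) => //; apply: zgroupN => //; apply: TS.
Qed.

Lemma unit_class_eq u u' : units S u -> units S u' ->
  ([set u * h | h in units T] = [set u' * h | h in units T]
   <-> exists2 t, units T t & u' = u * t).
Proof.
move=> Uu Uu'; split.
  move=> eqc; have : [set u' * h | h in units T] u'.
    exists 1; last by rewrite mulr1.
    by split; last exists 1; rewrite ?mulr1 //; apply: subring1.
  by rewrite -eqc => -[t Ut <-]; exists t.
case=> t [Tt [w Tw tw]] ->; apply/seteqP; split=> _ [h [Th [g Tg hg]] <-].
  exists (w * h); last by rewrite -mulrA [t * _]mulrA tw mul1r.
  split; first exact: subringM.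
  exists (t * g); first exact: subringM.
  by rewrite mulrACA [w * t]mulrC tw hg mulr1.
exists (t * h); last by rewrite mulrA.
split; first exact: subringM.
exists (w * g); first exact: subringM.
by rewrite mulrACA tw hg mulr1.
Qed.

Lemma extension_kernel_unit_index : finite_set extension_kernel ->
  ncard extension_kernel =
  (unit_index S T * ncard (ideal_class T @` extension_kernel))%N.
Proof.
move=> finX; have e : extension_kernel = id @` extension_kernel by rewrite image_id.
rewrite {1}e; apply: ncard_fibers; first by rewrite -e.
  by move=> ? ? _ _ ->.
move=> J0 [invJ0 J0S]; have [J0' invJ0' J0J0'] := invertible_inverse invJ0.
have mJ0 := invertible_submod invJ0.
apply/esym; apply: (ncard_image_of (f := fun u => dilate u J0)).
- move=> u [Su [v Sv uv]]; have uu : unitK u by exists v.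
  have invuJ := invertible_dilate uu invJ0.
  split; last by apply/esym/(ideal_class_eq ordT) => //;
    [apply: invertible_submod|exists u].
  split=> //; rewrite dilate_prod J0S; apply/seteqP; split=> [_ [s Ss <-]|s Ss].
    exact: subringM.
  by exists (v * s); [apply: subringM|rewrite mulrA uv mul1r].
- move=> J [[invJ JS] /esym/(ideal_class_eq ordT mJ0 (invertible_submod invJ))].
  case=> x ux JE; exists x; last by rewrite JE.
  have xS : dilate x S = S by rewrite -[LHS](_ : set_prod J S = _) // JE dilate_prod J0S.
  split; first by rewrite -xS; exists 1; [apply: subring1|rewrite mulr1].
  by have := subring1 rS; rewrite -{1}xS => -[y Sy xy]; exists y.
move=> u u' Uu Uu'; split.
  move/(unit_class_eq Uu Uu') => [t [Tt [w Tw tw]] ->]; rewrite dilateM; congr dilate.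
  apply/seteqP; split=> [y Jy|_ [y Jy <-]]; last by case: mJ0 => _; apply.
  exists (w * y); last by rewrite mulrA tw mul1r.
  by case: mJ0 => _; apply.
move=> eqJ; apply/(unit_class_eq Uu Uu').
have eqT : dilate u T = dilate u' T.
  by rewrite -J0J0' -!dilate_prod -!/(dilate _ _) eqJ.
have [t Tt tE] : dilate u T u' by rewrite eqT; exists 1; [apply: subring1|rewrite mulr1].
have [w Tw wE] : dilate u' T u by rewrite -eqT; exists 1; [apply: subring1|rewrite mulr1].
exists t => //; split=> //; exists w => //.
case: Uu => Su [v Sv uv]; have : v * (u * t * w) = v * u by rewrite tE wE.
by rewrite !mulrA [v * u]mulrC uv mul1r.
Qed.

Lemma class_number_extension :
  class_number T = (ncard (ideal_class T @` extension_kernel) * class_number S)%N.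
Proof.
rewrite !class_numberE.
have -> : ideal_class S @` invertible_ideals S =
    (fun I => ideal_class S (set_prod I S)) @` invertible_ideals T.
  apply/seteqP; split=> _ [I invI <-].
    by have [J invJ <-] := extension_surjective invI; exists J.
  by exists (set_prod I S) => //; apply: extension_invertible.
apply: ncard_fibers; first exact: finite_ideal_classes.
  move=> I J invI invJ /(ideal_class_eq ordT (invertible_submod invI) (invertible_submod invJ)).
  case=> x ux ->; apply/(ideal_class_eq ordS).
  - exact: (invertible_submod (extension_invertible invI)).
  - by rewrite dilate_prod;
    apply/dilate_submod/(invertible_submod (extension_invertible invI)).
  by exists x => //; rewrite dilate_prod.
move=> I0 invI0; have [I0' invI0' II'] := invertible_inverse invI0.
apply/esym; apply: (ncard_image_of (f := set_prod I0)).
- move=> J [invJ JS]; split; first exact: invertible_prod.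
  congr (ideal_class S _).
  by rewrite -extension_mul JS -set_prodA order_prod_id.
- move=> I [invI /esym/(ideal_class_eq ordS (invertible_submod (extension_invertible invI0))
    (invertible_submod (extension_invertible invI)))[x ux IS]].
  case: (ux) => y xy; have uy : unitK y by exists x; rewrite mulrC.
  exists (dilate y (set_prod I I0')).
    split; first by apply: invertible_dilate => //; apply: invertible_prod.
    rewrite dilate_prod -extension_mul IS dilate_prod extension_mul II' extension_prod.
    by rewrite -dilateM mulrC xy dilate1.
  apply/(ideal_class_eq ordT); first exact: invertible_submod.
    apply/invertible_submod/invertible_prod => //.
    by apply: invertible_dilate => //; apply: invertible_prod.
  exists y => //; rewrite set_prodC dilate_prod -set_prodA [set_prod I0' _]set_prodC II'.
  by rewrite invertible_mulr.
move=> J J' [invJ JS] [invJ' J'S].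
have mJ := invertible_submod invJ; have mJ' := invertible_submod invJ'.
have mIJ := invertible_submod (invertible_prod ordT invI0 invJ).
have mIJ' := invertible_submod (invertible_prod ordT invI0 invJ').
split=> [/(ideal_class_eq ordT mJ mJ')|/(ideal_class_eq ordT mIJ mIJ')] [x ux E].
  by apply/(ideal_class_eq ordT mIJ mIJ'); exists x => //;
    rewrite E set_prodC dilate_prod set_prodC.
apply/(ideal_class_eq ordT mJ mJ'); exists x => //.
have cancel L : invertible_ideals T L -> set_prod I0' (set_prod I0 L) = L.
  by move=> invL; rewrite set_prodA [set_prod I0' _]set_prodC II' set_prodC invertible_mulr.
by rewrite -[LHS]cancel // E set_prodC dilate_prod set_prodC cancel.
Qed.

Lemma class_number_ratio : finite_set extension_kernel -> (0 < ncard extension_kernel)%N ->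
  (class_number T)%:R / (class_number S)%:R
  = (ncard extension_kernel)%:R / (unit_index S T)%:R :> rat.
Proof.
move=> finX; rewrite (extension_kernel_unit_index finX) class_number_extension.
set h := class_number S; set k := ncard _; set u := unit_index S T.
rewrite muln_gt0 => /andP[u_gt0 k_gt0].
have h_gt0 : (0 < h)%N.
  rewrite /h class_numberE; apply: ncard_gt0; first exact: finite_ideal_classes.
  by exists S => //; apply: order_invertible.
rewrite !natrM mulfK ?pnatr_eq0 -?lt0n //.
by rewrite mulrAC divff ?mul1r // pnatr_eq0 -lt0n.
Qed.

End ExactSequence.
End InvertibleIdeals.

(** * Quadratic extensions modulo a common maximal ideal *)

Section QuadraticExtension.
Variable K : comNzRingType.
Implicit Types (A B N : set K) (s t x y z a b m : K).
Variables R l T S M : set K.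
Hypotheses (ordR : is_order R) (ordT : is_order T) (ordS : is_order S).
Hypotheses (TS : T `<=` S) (RT : R `<=` T).
Hypothesis maxM : maximal_ideal T M.
Hypothesis SM : submod S M.
Hypothesis natM : exists2 c : nat, (0 < c)%N & M c%:R.
Hypothesis MR : M `&` R = l.
Hypothesis residue : forall t, T t -> exists2 r, R r & M (t - r).

Let rT := order_subring ordT.
Let rS := order_subring ordS.
Let rR := order_subring ordR.
Let gT := subring_zgroup rT.
Let gS := subring_zgroup rS.
Let gR := subring_zgroup rR.
Let gM := maximal_zgroup maxM.
Let MT := maximal_sub maxM.
Let M1 := maximal_not1 maxM.
Let SMm x m : S x -> M m -> M (x * m). Proof. by case: SM => _; apply. Qed.
Let SMr x m : S x -> M m -> M (m * x). Proof. by rewrite mulrC; apply: SMm. Qed.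
Let T1 : T 1 := subring1 rT.
Let S1 : S 1 := subring1 rS.
Let MS m (Mm : M m) : S m := TS (MT Mm).

Lemma residue_ideal_zgroup : zgroup l.
Proof.
rewrite -MR; split; first by split; apply: zgroup0.
by move=> x y [Mx Rx] [My Ry]; split; apply: zgroupB.
Qed.

Lemma residue_idealP r : R r -> (l r <-> M r).
Proof. by move=> Rr; rewrite -MR; split=> [[]|]. Qed.

Lemma residue_cosets_finite : finite_set (coset l @` R).
Proof.
have [c c_gt0 Mc] := natM.
apply: (finite_cosets (order_lattice ordR) c_gt0 residue_ideal_zgroup) => x Rx.
apply/residue_idealP; first exact: zgroupMn.
by rewrite -mulr_natl; apply: SMr => //; apply/TS/RT.
Qed.

Lemma residue_cardE : residue_card R l = ncard (coset l @` R).
Proof. by []. Qed.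

Lemma residue_card_nonzero :
  residue_card R l = (ncard (coset l @` (R `\` l))).+1.
Proof.
rewrite residue_cardE; have gl := residue_ideal_zgroup.
have l0 : l 0 by apply: zgroup0.
have -> : coset l @` R = coset l 0 |` (coset l @` (R `\` l)).
  apply/seteqP; split=> [_ [r Rr <-]|_ [->|[r [Rr _] <-]]]; last by exists r.
    have [lr|nlr] := pselect (l r); last by right; exists r.
    by left; apply/(coset_eq gl); rewrite subr0.
  by exists 0 => //; apply: zgroup0.
apply: ncard_setU1; last by case=> r [Rr nlr] /(coset_eq gl); rewrite subr0.
apply: sub_finite_set residue_cosets_finite => _ [r [Rr _] <-].
by exists r.
Qed.

Local Notation line := (line T M S).
Local Notation unit_mod := (unit_mod S M).
Local Notation kernel := (extension_kernel T S).

Lemma line_eqP s s' : unit_mod s -> unit_mod s' ->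
  (line s = line s' <-> exists2 t, T t /\ ~ M t & M (s' - s * t)).
Proof. exact: line_eq ordT ordS TS maxM SM s s'. Qed.

Lemma kernelP I : kernel I <-> exists2 s, unit_mod s & I = line s.
Proof. exact: extension_kernelP ordT ordS TS maxM SM natM I. Qed.

Lemma unit_mod1 : unit_mod 1.
Proof. by split=> //; exists 1 => //; rewrite mulr1 subrr; apply: zgroup0. Qed.

Lemma kernel_nonempty : kernel (line 1).
Proof. by apply/kernelP; exists 1 => //; apply: unit_mod1. Qed.

Lemma primitive_local N : submod S N -> ~ N 1 ->
  (forall s, S s -> ~ N s -> unit_mod s) ->
  forall A B, submod S A -> submod S B -> set_prod A B = S ->
  exists a b, [/\ A a, B b & M (1 - a * b)].
Proof.
move=> [gN _] N1 unitN A B _ [_ SB] AB; apply: contrapT => nex; apply: N1.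
suff : set_prod A B `<=` N by apply; rewrite AB.
apply: set_prod_sub => // a b Aa Bb; apply: contrapT => nNab.
have [|_ [s Ss Ms]] := unitN (a * b) _ nNab; first by rewrite -AB; apply: set_prodM.
by apply: nex; exists a, (s * b); split=> //; [apply: (SB)|rewrite mulrCA [s * _]mulrC].
Qed.

Lemma primitive_split N1 N2 e : submod S N1 -> submod S N2 -> ~ N1 1 -> ~ N2 1 ->
  S e -> N1 (1 - e) -> N2 e ->
  (forall s, S s -> ~ N1 s -> ~ N2 s -> unit_mod s) ->
  forall A B, submod S A -> submod S B -> set_prod A B = S ->
  exists a b, [/\ A a, B b & M (1 - a * b)].
Proof.
move=> [gN1 SN1] [gN2 SN2] N11 N21 Se N1e N2e unitN A B [gA SA] [gB SB] AB.
have S1e : S (1 - e) by apply: zgroupB.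
have pick N : zgroup N -> ~ N 1 -> exists a b, [/\ A a, B b & ~ N (a * b)].
  move=> gN N1'; apply: contrapT => nex; apply: N1'.
  suff : set_prod A B `<=` N by apply; rewrite AB.
  apply: set_prod_sub => // a b Aa Bb; apply: contrapT => nNab.
  by apply: nex; exists a, b.
have [a1 [b1 [Aa1 Bb1 nN1]]] := pick N1 gN1 N11.
have [a2 [b2 [Aa2 Bb2 nN2]]] := pick N2 gN2 N21.
pose a := e * a1 + (1 - e) * a2; pose b := e * b1 + (1 - e) * b2.
have Aa : A a by apply: zgroupD => //; apply: (SA).
have Bb : B b by apply: zgroupD => //; apply: (SB).
have ABS a' b' : A a' -> B b' -> S (a' * b') by rewrite -AB; apply: set_prodM.
have [||_ [s Ss Ms]] := unitN (a * b) (ABS _ _ Aa Bb).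
- move=> Nab; apply: nN1; rewrite (_ : a1 * b1 = a * b +
    (a1 * b1 + e * (a1 * b1) - e * (a1 * b2) - e * (a2 * b1) - (1 - e) * (a2 * b2))
      * (1 - e)); last by rewrite /a /b; ring.
  apply: zgroupD => //; apply: (SN1) => //.
  by do ?[by apply: ABS|apply: zgroupB => //|apply: zgroupD => //|apply: subringM => //].
- move=> Nab; apply: nN2; rewrite (_ : a2 * b2 = a * b +
    ((1 + (1 - e)) * (a2 * b2) - (1 - e) * (a1 * b2) - (1 - e) * (a2 * b1) - e * (a1 * b1))
      * e); last by rewrite /a /b; ring.
  apply: zgroupD => //; apply: (SN2) => //.
  by do ?[by apply: ABS|apply: zgroupB => //|apply: zgroupD => //|apply: subringM => //].
by exists a, (s * b); split=> //; [apply: (SB)|rewrite mulrCA [s * _]mulrC].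
Qed.

Variable x : K.
Hypotheses (Sx : S x) (nTx : ~ T x).
Hypothesis spanx : forall s, S s -> exists a b, [/\ T a, T b & M (s - (a + b * x))].

Lemma coordinates a b : T a -> T b -> M (a + b * x) -> M a /\ M b.
Proof.
move=> Ta Tb Mab; suff Mb : M b.
  by split=> //; rewrite -[a](addrK (b * x)); apply: zgroupB => //; apply: SMr.
apply: contrapT => nMb; apply: nTx.
apply: (maximal_cancel rT maxM gT) Tb nMb _.
- by move=> *; apply: subringM.
- by move=> m Mm; apply/MT/SMr.
by rewrite -[_ * _](addKr a); apply: zgroupD => //; [apply: zgroupN|apply: MT].
Qed.

Lemma line_1bx_eq b b' : R b -> R b' -> unit_mod (1 + b * x) -> unit_mod (1 + b' * x) ->
  (coset l b = coset l b' <-> line (1 + b * x) = line (1 + b' * x)).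
Proof.
move=> Rb Rb' Ub Ub'; rewrite coset_eq ?residue_idealP //;
  last exact: residue_ideal_zgroup.
  have [Tb Tb'] := (RT Rb, RT Rb').
  rewrite line_eqP //; split=> [Mbb|[t [Tt nMt] Mt]].
    exists 1 => //; rewrite (_ : _ - _ = - (b - b') * x); last by ring.
    by apply: SMr => //; apply: zgroupN.
  have [] := @coordinates (1 - t) (b' - b * t).
  - exact: zgroupB.
  - by apply: zgroupB => //; apply: subringM.
  - by rewrite (_ : _ + _ = 1 + b' * x - (1 + b * x) * t) //; ring.
  move=> Mt1 Mbt; rewrite (_ : b - b' = - (b * (t - 1)) + - (b' - b * t) * 1);
    last by ring.
  rewrite mulr1; apply: zgroupD => //; last exact: zgroupN.
  apply: zgroupN => //; apply: (maximal_mul maxM) => //.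
  by rewrite -opprB; apply: zgroupN.
exact: zgroupB.
Qed.

Lemma line_1bx_rep s a b : unit_mod s -> T a -> T b -> M (s - (a + b * x)) -> ~ M a ->
  (forall r, R r -> unit_mod (1 + r * x)) ->
  exists2 r, R r & line s = line (1 + r * x).
Proof.
move=> Us Ta Tb Ms nMa unit1; have [u Tu Mu] := maximal_inv rT maxM Ta nMa.
have [r Rr Mr] := residue (subringM rT Tb Tu); have Tr := RT Rr.
exists r => //; apply/esym/line_eqP => //; first exact: unit1.
exists a => //.
rewrite (_ : _ - _ = s - (a + b * x) + b * x * (1 - a * u) + a * x * (b * u - r));
  last by ring.
have STx t : T t -> S (t * x) by move=> Tt; apply: subringM => //; apply: TS.
by apply: zgroupD => //; [apply: zgroupD => //|]; apply: SMm => //; apply: STx.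
Qed.

Section Ramified.
Hypothesis Mxx : M (x * x).

Lemma ramified_unit s a b : S s -> T a -> T b -> M (s - (a + b * x)) ->
  (~ M a <-> unit_mod s).
Proof.
move=> Ss Ta Tb Ms; split=> [nMa|[_ [s' Ss' Mss']] Ma].
  have [u Tu Mu] := maximal_inv rT maxM Ta nMa;
    have [Sa [Sb Su]] := (TS Ta, (TS Tb, TS Tu)).
  split=> //; exists (u * (1 - u * b * x)).
    by do ?[apply: subringM => //|apply: zgroupB => //].
  rewrite (_ : 1 - _ = - (u * (1 - u * b * x)) * (s - (a + b * x)) + (1 - a * u)
    + (u * b * x) * (- (1 - a * u)) + u * u * b * b * (x * x)); last by ring.
  have Sub : S (u * b * x) by do 2!apply: subringM => //.
  apply: zgroupD => //; last by apply: SMm => //; do 3!apply: subringM => //.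
  apply: zgroupD => //; last by apply: SMm => //; apply: zgroupN.
  apply: zgroupD => //; apply: SMm => //; apply: zgroupN => //; apply: subringM => //.
  exact: zgroupB.
apply: M1; have [Sa Sb] := (TS Ta, TS Tb).
rewrite (_ : 1 = (1 + s * s') * (1 - s * s') + s' * s' * (s + a + b * x) * (s - (a + b * x))
  + s' * s' * (a + 2 * b * x) * a + s' * s' * b * b * (x * x)); last by ring.
have S2 : S 2 by apply: subring_nat.
apply: zgroupD => //; last by apply: SMm => //; do ?apply: subringM => //.
apply: zgroupD => //; last first.
  by apply: SMm => //;
    do ?[apply: subringM => //|apply: zgroupB => //|apply: zgroupD => //|apply: zgroupN => //].
by apply: zgroupD => //; apply: SMm => //;
  do ?[apply: subringM => //|apply: zgroupB => //|apply: zgroupD => //|apply: zgroupN => //].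
Qed.

Lemma ramified_kernel : finite_set kernel /\ ncard kernel = residue_card R l.
Proof.
have unit1 r : R r -> unit_mod (1 + r * x).
  move=> Rr; apply/(@ramified_unit _ 1 r) => //.
  - by apply: zgroupD => //; apply: subringM => //; apply/TS/RT.
  - exact: RT.
  by rewrite subrr; apply: zgroup0.
have eqc : card_eq (coset l @` R) (id @` kernel).
  apply: (card_eq_image_of (f := fun r => line (1 + r * x))).
  - by move=> r Rr; apply/kernelP; exists (1 + r * x) => //; apply: unit1.
  - move=> I /kernelP[s Us ->]; case: (Us) => Ss _.
    have [a [b [Ta Tb Ms]]] := spanx Ss.
    have [r Rr eqs] := line_1bx_rep Us Ta Tb Ms (iffRL (ramified_unit Ss Ta Tb Ms) Us) unit1.
    by exists r.
  by move=> b b' Rb Rb'; apply: line_1bx_eq => //; apply: unit1.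
rewrite image_id in eqc; split.
  exact: card_eq_finite eqc residue_cosets_finite.
by rewrite residue_cardE (card_eq_ncard eqc).
Qed.

Lemma ramified_primitive A B : submod S A -> submod S B -> set_prod A B = S ->
  exists a b, [/\ A a, B b & M (1 - a * b)].
Proof.
pose N := [set s | S s /\ M (s * x)].
apply: (@primitive_local N).
- split; first split.
  + by split; [apply: zgroup0|rewrite mul0r; apply: zgroup0].
  + by move=> y z [Sy My] [Sz Mz]; split; [apply: zgroupB|rewrite mulrBl; apply: zgroupB].
  by move=> y z Sy [Sz Mz]; split; [apply: subringM|rewrite -mulrA; apply: SMm].
- by case=> _; rewrite mul1r => /MT.
move=> s Ss nNs; have [a [b [Ta Tb Ms]]] := spanx Ss.
apply/(ramified_unit Ss Ta Tb Ms) => Ma; apply: nNs; split=> //.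
rewrite (_ : s * x = (s - (a + b * x)) * x + a * x + b * (x * x)); last by ring.
apply: zgroupD => //; last by apply: SMm => //; apply: TS.
by apply: zgroupD => //; apply: SMr.
Qed.

End Ramified.

Section Inert.
Hypothesis maxSM : maximal_ideal S M.

Lemma inert_unit s : S s -> ~ M s -> unit_mod s.
Proof. by move=> Ss nMs; split=> //; apply: (maximal_inv rS maxSM). Qed.

Lemma inert_kernel : finite_set kernel /\ ncard kernel = (residue_card R l).+1.
Proof.
have unit1 r : R r -> unit_mod (1 + r * x).
  move=> Rr; have Tr := RT Rr; apply: inert_unit.
    by apply: zgroupD => //; apply: subringM => //; apply: TS.
  by move/(coordinates T1 Tr) => -[/M1].
have unitx : unit_mod x by apply: inert_unit => // /MT.
pose X := (fun r => line (1 + r * x)) @` R.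
have eqc : card_eq (coset l @` R) X.
  by apply: card_eq_images => b b' Rb Rb'; apply: line_1bx_eq => //; apply: unit1.
have finX := card_eq_finite eqc residue_cosets_finite.
have -> : kernel = line x |` X.
  apply/seteqP; split=> [I /kernelP[s Us ->]|I [->|[r Rr <-]]]; last 2 first.
  - by apply/kernelP; exists x.
  - by apply/kernelP; exists (1 + r * x) => //; apply: unit1.
  have [Ss [s' Ss' Mss']] := Us; have [a [b [Ta Tb Ms]]] := spanx Ss.
  have [Ma|nMa] := pselect (M a); last first.
    by have [r Rr ->] := line_1bx_rep Us Ta Tb Ms nMa unit1; right; exists r.
  left; apply/esym/line_eqP => //; exists b.
    split=> // Mb; apply: M1.
    rewrite (_ : 1 = (1 - s * s') + s' * (s - (a + b * x)) + s' * a + s' * x * b);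
      last by ring.
    apply: zgroupD => //; last by apply: SMm => //; apply: subringM.
    by do 2?[apply: zgroupD => //]; apply: SMm.
  by rewrite (_ : _ - _ = s - (a + b * x) + a); [apply: zgroupD|ring].
split; first by rewrite finite_setU; split.
rewrite ncard_setU1 //; first by rewrite residue_cardE (card_eq_ncard eqc).
case=> r Rr /(line_eqP (unit1 r Rr) unitx)[t [Tt nMt]].
rewrite (_ : _ - _ = - t + (1 - r * t) * x); last by ring.
case/coordinates; first exact: zgroupN.
  by apply: zgroupB => //; apply: subringM => //; apply: RT.
by move/(zgroupN gM); rewrite opprK.
Qed.

Lemma inert_primitive A B : submod S A -> submod S B -> set_prod A B = S ->
  exists a b, [/\ A a, B b & M (1 - a * b)].
Proof. by apply: (@primitive_local M) => //; apply: inert_unit. Qed.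

End Inert.

Section Split.
Hypothesis Mxx : M (x * x - x).

Lemma split_decomposition s : S s ->
  exists a b, [/\ T a, T b & M (s - (a * x + b * (1 - x)))].
Proof.
move=> Ss; have [a [b [Ta Tb Ms]]] := spanx Ss.
exists (a + b), a; split=> //; first exact: zgroupD.
by rewrite (_ : (a + b) * x + a * (1 - x) = a + b * x) //; ring.
Qed.

Lemma split_coordinates a b : T a -> T b -> M (a * x + b * (1 - x)) -> M a /\ M b.
Proof.
move=> Ta Tb Mab; have [] := @coordinates b (a - b) Tb (zgroupB gT Ta Tb).
  by rewrite (_ : b + (a - b) * x = a * x + b * (1 - x)) //; ring.
by move=> Mb Mab'; split=> //; rewrite -[a](subrK b); apply: zgroupD.
Qed.

Definition split_ideal1 : set K := [set s | S s /\ M (s * x)].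
Definition split_ideal2 : set K := [set s | S s /\ M (s * (1 - x))].

Let S1x : S (1 - x). Proof. exact: zgroupB. Qed.

Lemma split_ideal1P s a b : S s -> T a -> T b -> M (s - (a * x + b * (1 - x))) ->
  (split_ideal1 s <-> M a).
Proof.
move=> Ss Ta Tb Ms; have [Sa Sb] := (TS Ta, TS Tb).
have Mrest : M ((s - (a * x + b * (1 - x))) * x + (a - b) * (x * x - x)).
  by apply: zgroupD => //; [apply: SMr|apply: SMm => //; apply: zgroupB].
have E : s * x = (s - (a * x + b * (1 - x))) * x + (a - b) * (x * x - x) + a * x by ring.
split=> [[_ Msx]|Ma]; last by split=> //; rewrite E; apply: zgroupD => //; apply: SMr.
have [] // := @split_coordinates a 0 Ta (zgroup0 gT).
by rewrite mul0r addr0 -[a * x](addKr ((s - (a * x + b * (1 - x))) * x + (a - b) * (x * x - x))) -E;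
  apply: zgroupD => //; apply: zgroupN.
Qed.

Lemma split_ideal2P s a b : S s -> T a -> T b -> M (s - (a * x + b * (1 - x))) ->
  (split_ideal2 s <-> M b).
Proof.
move=> Ss Ta Tb Ms; have [Sa Sb] := (TS Ta, TS Tb).
set w := (s - (a * x + b * (1 - x))) * (1 - x) + (b - a) * (x * x - x).
have Mrest : M w.
  by apply: zgroupD => //; [apply: SMr|apply: SMm => //; apply: zgroupB].
have E : s * (1 - x) = w + b * (1 - x) by rewrite /w; ring.
split=> [[_ Msx]|Mb]; last by split=> //; rewrite E; apply: zgroupD => //; apply: SMr.
have [] // := @split_coordinates 0 b (zgroup0 gT) Tb.
by rewrite mul0r add0r -[b * _](addKr w) -E; apply: zgroupD => //; apply: zgroupN.
Qed.

Lemma split_ideal_submod (y : K) : S y -> submod S [set s | S s /\ M (s * y)].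
Proof.
move=> Sy; split; first split.
- by split; [apply: zgroup0|rewrite mul0r; apply: zgroup0].
- by move=> z w [Sz Mz] [Sw Mw]; split; [apply: zgroupB|rewrite mulrBl; apply: zgroupB].
by move=> z w Sz [Sw Mw]; split; [apply: subringM|rewrite -mulrA; apply: SMm].
Qed.

Lemma split_ideal1_mem : split_ideal1 (1 - x).
Proof.
split=> //; rewrite (_ : _ * _ = - (x * x - x)); last by ring.
exact: zgroupN.
Qed.

Lemma split_ideal2_mem : split_ideal2 x.
Proof.
split=> //; rewrite (_ : _ * _ = - (x * x - x)); last by ring.
exact: zgroupN.
Qed.

Lemma split_ideal1_1 : ~ split_ideal1 1.
Proof. by case=> _; rewrite mul1r => /MT. Qed.

Lemma split_ideal2_1 : ~ split_ideal2 1.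
Proof.
by case=> _; rewrite mul1r => /MT T1x; apply: nTx; rewrite -[x](subKr 1); apply: zgroupB.
Qed.

Lemma split_unit s : S s -> ~ split_ideal1 s -> ~ split_ideal2 s -> unit_mod s.
Proof.
move=> Ss n1 n2; have [a [b [Ta Tb Ms]]] := split_decomposition Ss.
have nMa : ~ M a by move/(split_ideal1P Ss Ta Tb Ms).
have nMb : ~ M b by move/(split_ideal2P Ss Ta Tb Ms).
have [u Tu Mu] := maximal_inv rT maxM Ta nMa.
have [v Tv Mv] := maximal_inv rT maxM Tb nMb.
have [[Sa Sb] [Su Sv]] := ((TS Ta, TS Tb), (TS Tu, TS Tv)).
have Sw : S (u * x + v * (1 - x)) by apply: zgroupD => //; apply: subringM.
split=> //; exists (u * x + v * (1 - x)) => //.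
rewrite (_ : 1 - _ = - (u * x + v * (1 - x)) * (s - (a * x + b * (1 - x)))
  + x * (1 - a * u) + (1 - x) * (1 - b * v)
  + (a * v + b * u - a * u - b * v) * (x * x - x)); last by ring.
apply: zgroupD => //; last first.
  by apply: SMm => //;
    do ?[apply: subringM => //|apply: zgroupB => //|apply: zgroupD => //|apply: zgroupN => //].
by apply: zgroupD => //; [apply: zgroupD => //|]; apply: SMm => //; apply: zgroupN.
Qed.

Lemma split_unit_not s : unit_mod s -> ~ split_ideal1 s /\ ~ split_ideal2 s.
Proof.
move=> [Ss [s' Ss' Mss']].
have notin y : S y -> ~ M y -> ~ M (s * y).
  move=> Sy nMy Msy; apply: nMy; rewrite (_ : y = (1 - s * s') * y + s' * (s * y));
    last by ring.
  by apply: zgroupD => //; [apply: SMr|apply: SMm].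
split=> -[_]; apply: notin => //; first by move/MT.
by move=> M1x; case: split_ideal2_1; split=> //; rewrite mul1r.
Qed.

Lemma split_primitive A B : submod S A -> submod S B -> set_prod A B = S ->
  exists a b, [/\ A a, B b & M (1 - a * b)].
Proof.
apply: (@primitive_split split_ideal1 split_ideal2 x) => //.
- exact: split_ideal_submod.
- exact: split_ideal_submod.
- exact: split_ideal1_1.
- exact: split_ideal2_1.
- exact: split_ideal1_mem.
- exact: split_ideal2_mem.
exact: split_unit.
Qed.

Lemma split_kernel : finite_set kernel /\ (ncard kernel).+1 = residue_card R l.
Proof.
have unitb b : (R `\` l) b -> unit_mod (x + b * (1 - x)).
  move=> [Rb]; rewrite residue_idealP // => nMb; have Tb := RT Rb.
  have Ss : S (x + b * (1 - x)) by apply: zgroupD => //; apply: subringM => //; apply: TS.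
  have Ms : M (x + b * (1 - x) - (1 * x + b * (1 - x))).
    by rewrite mul1r subrr; apply: zgroup0.
  apply: split_unit => //; first by move/(split_ideal1P Ss T1 Tb Ms).
  by move/(split_ideal2P Ss T1 Tb Ms).
have eqc : card_eq (coset l @` (R `\` l)) (id @` kernel).
  apply: (card_eq_image_of (f := fun b => line (x + b * (1 - x)))).
  - by move=> b Rb; apply/kernelP; exists (x + b * (1 - x)) => //; apply: unitb.
  - move=> I /kernelP[s Us ->]; have [Ss _] := Us.
    have [a [b [Ta Tb Ms]]] := split_decomposition Ss.
    have [n1 n2] := split_unit_not Us.
    have nMa : ~ M a by move/(split_ideal1P Ss Ta Tb Ms).
    have nMb : ~ M b by move/(split_ideal2P Ss Ta Tb Ms).
    have [u Tu Mu] := maximal_inv rT maxM Ta nMa.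
    have [r Rr Mr] := residue (subringM rT Tb Tu).
    have Mb : M (b - r * a).
      rewrite (_ : _ - _ = b * (1 - a * u) + a * (b * u - r)); last by ring.
      by apply: zgroupD => //; apply: (maximal_mul maxM).
    have Rlr : (R `\` l) r.
      split=> //; rewrite residue_idealP // => Mr'; apply: nMb.
      rewrite -[b](subrK (r * a)); apply: zgroupD => //.
      by rewrite mulrC; apply: (maximal_mul maxM).
    exists r => //; apply/esym/line_eqP => //; first exact: unitb.
    exists a => //; rewrite (_ : _ - _ = s - (a * x + b * (1 - x)) + (1 - x) * (b - r * a)); last by ring.
    by apply: zgroupD => //; apply: SMm.
  move=> b b' Rb Rb'; have [[Rb1 nlb] [Rb1' nlb']] := (Rb, Rb').
  have [Tb Tb'] := (RT Rb1, RT Rb1').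
  rewrite coset_eq; last exact: residue_ideal_zgroup.
  rewrite residue_idealP; last exact: zgroupB.
  rewrite line_eqP; [|exact: unitb|exact: unitb]; split=> [Mbb|[t [Tt nMt] Mt]].
    exists 1 => //; rewrite (_ : _ - _ = - (1 - x) * (b - b')); last by ring.
    by apply: SMm => //; apply: zgroupN.
  have [] := @split_coordinates (1 - t) (b' - b * t).
  - exact: zgroupB.
  - by apply: zgroupB => //; apply: subringM.
  - by rewrite (_ : (1 - t) * x + (b' - b * t) * (1 - x) = x + b' * (1 - x) - (x + b * (1 - x)) * t) //; ring.
  move=> Mt1 Mbt; rewrite (_ : b - b' = b * (1 - t) * -1 + 2 * (b * (1 - t)) - (b' - b * t)); last by ring.
  have Mb1 : M (b * (1 - t)) by apply: (maximal_mul maxM).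
  apply: zgroupB => //; apply: zgroupD => //.
    by rewrite mulrN1; apply: zgroupN.
  by apply: (maximal_mul maxM) => //; apply: subring_nat.
rewrite image_id in eqc; have fin : finite_set (coset l @` (R `\` l)).
  by apply: sub_finite_set residue_cosets_finite => _ [r [Rr _] <-]; exists r.
split; first exact: card_eq_finite eqc fin.
by rewrite residue_card_nonzero (card_eq_ncard eqc).
Qed.

Lemma split_ideals_maximal : maximal_ideal S split_ideal1 /\ maximal_ideal S split_ideal2.
Proof.
have [n11 n21] := (split_ideal1_1, split_ideal2_1).
split; apply: maximal_idealI => //; try exact: split_ideal_submod.
- by move=> s [].
- move=> s Ss n1; have [a [b [Ta Tb Ms]]] := split_decomposition Ss.
  have nMa : ~ M a by move/(split_ideal1P Ss Ta Tb Ms).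
  have [u Tu Mu] := maximal_inv rT maxM Ta nMa;
    have [Sa [Sb Su]] := (TS Ta, (TS Tb, TS Tu)).
  exists u => //; apply/(@split_ideal1P _ (1 - a * u) (1 - b * u)) => //.
  + by apply: zgroupB => //; apply: subringM.
  + by apply: zgroupB => //; apply: subringM.
  + by apply: zgroupB => //; apply: subringM.
  rewrite (_ : _ - _ = - u * (s - (a * x + b * (1 - x)))); last by ring.
  by apply: SMm => //; apply: zgroupN.
- by move=> s [].
move=> s Ss n2; have [a [b [Ta Tb Ms]]] := split_decomposition Ss.
have nMb : ~ M b by move/(split_ideal2P Ss Ta Tb Ms).
have [u Tu Mu] := maximal_inv rT maxM Tb nMb;
  have [Sa [Sb Su]] := (TS Ta, (TS Tb, TS Tu)).
exists u => //; apply/(@split_ideal2P _ (1 - a * u) (1 - b * u)) => //.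
- by apply: zgroupB => //; apply: subringM.
- by apply: zgroupB => //; apply: subringM.
- by apply: zgroupB => //; apply: subringM.
rewrite (_ : _ - _ = - u * (s - (a * x + b * (1 - x)))); last by ring.
by apply: SMm => //; apply: zgroupN.
Qed.

Lemma split_ideals_prod : M = set_prod split_ideal1 split_ideal2.
Proof.
apply/seteqP; split=> [m Mm|].
  have [Mm1 Mm2] : split_ideal1 m /\ split_ideal2 m.
    by split; split; [exact: MS|apply: SMr|exact: MS|apply: SMr].
  have -> : m = m * x + (1 - x) * m by ring.
  apply: set_prodD; apply: set_prodM => //.
  - exact: split_ideal2_mem.
  exact: split_ideal1_mem.
apply: set_prod_sub => // y z [Sy My] [Sz Mz].
rewrite (_ : y * z = y * x * z + y * (z * (1 - x))); last by ring.
by apply: zgroupD => //; [apply: SMr|apply: SMm].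
Qed.

Lemma split_ideals_neq : split_ideal1 <> split_ideal2.
Proof.
move=> eq12; apply: split_ideal2_1; rewrite -[1](subrK x).
have [gN _] := split_ideal_submod S1x.
apply: (zgroupD gN); last exact: split_ideal2_mem.
by rewrite -/split_ideal2 -eq12; apply: split_ideal1_mem.
Qed.

End Split.

End QuadraticExtension.

Section SplittingSymbol.
Variable K : comNzRingType.
Implicit Types (S M N I J : set K) (x y z : K).

Lemma maximal_eq S M N : subring S -> maximal_ideal S M -> maximal_ideal S N ->
  M `<=` N -> M = N.
Proof.
move=> rS maxM maxN MN.
have [NM|N1] := maximal_or rS maxM (maximal_submod maxN) (maximal_sub maxN) MN.
  exact/seteqP.
by case: (maximal_not1 maxN N1).
Qed.

Lemma det_congruence S I m (B : 'M[K]_m) : subring S -> submod S I -> I `<=` S ->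
  (forall i j, I (B i j - (i == j)%:R)) -> I (\det B - 1).
Proof.
move=> rS [gI SI] IS BI; have gS := subring_zgroup rS.
have S01 (b : bool) : S b%:R by apply: subring_nat.
have SB i j : S (B i j) by rewrite -[B i j](subrK (i == j)%:R); apply: zgroupD => //;
  apply: IS.
rewrite -(det1 K m) -sumrB; apply: (zgroup_sum gI) => s _.
rewrite -mulrBr; apply: (SI).
  by apply: subringX => //; apply: zgroupN => //; apply: subring1.
suff [_ _] : [/\ S (\prod_i B i (s i)), S (\prod_i (1%:M : 'M[K]_m) i (s i))
  & I (\prod_i B i (s i) - \prod_i (1%:M : 'M[K]_m) i (s i))] by [].
elim/big_ind2: _ => [|x y z w [Sx Sy Ixy] [Sz Sw Izw]|i _].
- by split; [apply: subring1|apply: subring1|rewrite subrr; apply: zgroup0].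
- split; [exact: subringM|exact: subringM|].
  rewrite (_ : _ - _ = w * (y - x) + x * (w - z)); last by ring.
  by apply: zgroupD => //; apply: (SI).
by rewrite mxE.
Qed.

Lemma nakayama_idempotent S N : subring S -> submod S N -> N `<=` S -> lattice N ->
  set_prod N N = N -> exists2 n, N n & forall y, N y -> (1 - n) * y = 0.
Proof.
move=> rS mN NS [[m [b defN]] _] NN; have [gN SN] := mN.
rewrite -/(zspan b) in defN.
have rel i : exists a : 'I_m -> K, (forall j, N (a j)) /\ b i = \sum_j a j * b j.
  have : set_prod N N (b i) by rewrite NN defN; apply: zspan_gen.
  move: (b i); apply: set_prod_ind.
  - by exists (fun=> 0); split; [move=> _; apply: zgroup0|rewrite big1 // => j _;
    rewrite mul0r].
  - move=> _ _ [a [Na ->]] [a' [Na' ->]]; exists (fun j => a j + a' j).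
    split; first by move=> j; apply: zgroupD.
    by rewrite -big_split; apply: eq_bigr => j _; rewrite mulrDl.
  move=> n y Nn; rewrite {1}defN => -[c ->]; exists (fun j => n *~ c j).
  split; first by move=> j; apply: zgroupMz.
  by rewrite mulr_sumr; apply: eq_bigr => j _; rewrite mulrzAl mulrzAr.
have [a aP] := choice rel.
pose B : 'M[K]_m := 1%:M - \matrix_(i, j) a i j.
have Bb i : \det B * b i = 0.
  apply: det_annihilates => k; under eq_bigr do rewrite !mxE mulrBl.
  rewrite sumrB (bigD1 k) //= eqxx mul1r big1 ?addr0 => [|j /negPf jk].
    by rewrite -(proj2 (aP k)) subrr.
  by rewrite eq_sym jk mul0r.
exists (1 - \det B).
  rewrite -opprB; apply: (zgroupN gN); apply: (det_congruence rS mN NS) => i j.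
  by rewrite !mxE addrAC subrr add0r; apply: (zgroupN gN); case: (aP i).
move=> y; rewrite subKr defN => -[c ->]; rewrite mulr_sumr big1 // => j _.
by rewrite mulrzAr Bb mul0rz.
Qed.

Hypothesis HK : product_of_number_fields K.
Variables l S : set K.
Hypothesis ordS : is_order S.
Hypothesis natl : exists2 c : nat, (0 < c)%N & l c%:R.

Let rS := order_subring ordS.
Let gS := subring_zgroup rS.

Lemma ideal_lattice (N : set K) c : (0 < c)%N -> submod S N -> N `<=` S -> N c%:R -> lattice N.
Proof.
move=> c_gt0 [gN SN] NS Nc; apply: sublattice (order_lattice ordS) c_gt0 gN NS _.
by move=> x Sx; rewrite -mulr_natr; apply: SN.
Qed.

Let natX : exists2 c : nat, (0 < c)%N & set_prod l S c%:R.
Proof.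
have [c c_gt0 lc] := natl; exists c => //.
by rewrite -[c%:R]mulr1; apply: set_prodM => //; apply: subring1.
Qed.

Let prod_subl (M N : set K) : maximal_ideal S M -> N `<=` S -> set_prod M N `<=` M.
Proof.
move=> maxM NS; apply: set_prod_sub; first exact: maximal_zgroup maxM.
by move=> a b Ma Nb; rewrite mulrC; apply: (maximal_mul maxM) => //; apply: NS.
Qed.

Lemma inert_not_ramified : inert_in l S -> ~ ramified_in l S.
Proof.
move=> maxX [N maxN XE]; have [c c_gt0 Xc] := natX.
have XN : set_prod l S = N.
  by apply: (maximal_eq rS maxX maxN); rewrite XE; apply: prod_subl (maximal_sub maxN).
have NN : set_prod N N = N by rewrite -XE.
rewrite XN in Xc.
have latN := ideal_lattice c_gt0 (maximal_submod maxN) (maximal_sub maxN) Xc.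
have [n Nn ann] := nakayama_idempotent rS (maximal_submod maxN) (maximal_sub maxN) latN NN.
apply: (maximal_not1 maxN); suff -> : 1 = n by [].
apply/eqP; rewrite -subr_eq0; apply/eqP/(mulrn_eq0_inj HK c_gt0).
by rewrite -mulr_natr ann.
Qed.

Lemma inert_not_split : inert_in l S -> ~ split_in l S.
Proof.
move=> maxX [M [N [maxM maxN MN XE]]]; apply: MN.
transitivity (set_prod l S);
  [apply/esym/(maximal_eq rS maxX maxM)|apply: (maximal_eq rS maxX maxN)]; rewrite XE.
  exact: prod_subl (maximal_sub maxN).
by rewrite set_prodC; apply: prod_subl (maximal_sub maxM).
Qed.

Lemma ramified_not_split : ramified_in l S -> ~ split_in l S.
Proof.
move=> [P maxP XE] [M [N [maxM maxN MN XE']]].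
have PP : set_prod P P = set_prod M N by rewrite -XE.
have half A B : maximal_ideal S A -> maximal_ideal S B ->
    set_prod P P = set_prod A B -> A `<=` P -> A = B.
  move=> maxA maxB AB AP; have eqAP := maximal_eq rS maxA maxP AP.
  rewrite eqAP; apply: (maximal_eq rS maxP maxB) => y Py; apply: contrapT => nBy.
  have SP := maximal_sub maxP.
  apply: nBy; apply: (maximal_expr rS maxB (k := 2) (SP y Py)).
  rewrite expr2; suff : set_prod A B `<=` B by apply; rewrite -AB; apply: set_prodM.
  by rewrite set_prodC; apply: prod_subl (maximal_sub maxA).
have [MP|/existsNP[a /not_implyP[Ma nPa]]] := pselect (M `<=` P).
  exact: MN (half M N maxM maxN PP MP).
apply: MN; apply/esym; apply: half => //; first by rewrite set_prodC.
move=> b Nb; apply: (maximal_prime rS maxP (maximal_sub maxM Ma) (maximal_sub maxN Nb)) => //.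
suff : set_prod P P `<=` P by apply; rewrite PP; apply: set_prodM.
exact: prod_subl (maximal_sub maxP).
Qed.

Lemma splitting_symbol_unique (d d' : int) :
  splitting_symbol l S d -> splitting_symbol l S d' -> d = d'.
Proof.
have [IR [IS RS]] := (inert_not_ramified, (inert_not_split, ramified_not_split)).
by case=> -[A ->] [] [B ->] //; [case: (IR A B)|case: (IS A B)|case: (IR B A)
  |case: (RS A B)|case: (IS B A)|case: (RS B A)].
Qed.

End SplittingSymbol.

(** * The multiplicator ladder *)

Section Ladder.
Variable K : comNzRingType.
Hypothesis HK : product_of_number_fields K.
Variables (R l : set K) (d : nat) (O : nat -> set K).
Hypothesis ordR : is_order R.
Hypothesis singl : singular_maximal_ideal R l.
Hypothesis ladO : ladder_in_overorders R l d O.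
Implicit Types (S T U M N I J : set K) (x y z t s m : K) (i j k : nat).

Local Notation L := (set_prod l (O d)).

Let rR := order_subring ordR.
Let gR := subring_zgroup rR.
Let maxl : maximal_ideal R l. Proof. by case: singl. Qed.
Let gl := maximal_zgroup maxl.
Let lR := maximal_sub maxl.
Let ordT : is_order (O d). Proof. by case: ladO => -[]. Qed.
Let RT : R `<=` O d. Proof. by case: ladO => -[]. Qed.
Let rT := order_subring ordT.
Let gT := subring_zgroup rT.
Let ladderT : multiplicator_ladder (O d) L d O. Proof. by case: ladO. Qed.

Lemma base_overorder : R `<=` O d. Proof. exact: RT. Qed.

Lemma locally_base x : O d x -> exists2 v, (R `\` l) v & R (v * x).
Proof.
move=> Tx; have l1 := maximal_not1 maxl; have R1 := subring1 rR.
have : localization R l (O d) (loc_frac R l x 1) by exists x, 1.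
case: ladO => _ -> _ [r [s [Rr [Rs nls] E]]].
have : loc_frac R l r s (r, s).
  by split=> //; exists 1; rewrite //= mul1r subrr.
rewrite -E => -[_ [u [Ru nlu] /= ux]]; exists (u * s).
  by split; [apply: subringM|move/(maximal_prime rR maxl Ru Rs)/(_ nlu)].
suff -> : u * s * x = u * r by apply: subringM.
by apply/eqP; rewrite -subr_eq0 -mulrA -mulrBr -[r]mul1r ux.
Qed.

Lemma base_ideal_local x : L x -> exists2 v, (R `\` l) v & l (v * x).
Proof.
have mulv v w : (R `\` l) v -> (R `\` l) w -> (R `\` l) (v * w).
  move=> [Rv nv] [Rw nw].
  by split; [apply: subringM|move/(maximal_prime rR maxl Rv Rw)/(_ nv)].
move: x; apply: set_prod_ind.
- exists 1; first by split; [apply: subring1|apply: maximal_not1 maxl].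
  by rewrite mulr0; apply: zgroup0.
- move=> x y [v Rv lx] [w Rw ly]; exists (v * w); first exact: mulv.
  rewrite (_ : _ * _ = w * (v * x) + v * (w * y)); last by ring.
  by apply: zgroupD => //; apply: (maximal_mul maxl) => //; [case: Rw|case: Rv].
move=> a b la Tb; have [v Rv Rvb] := locally_base Tb; exists v => //.
by rewrite mulrCA mulrC; apply: (maximal_mul maxl).
Qed.

Lemma base_ideal_sub : l `<=` L.
Proof. by move=> x lx; rewrite -[x]mulr1; apply: set_prodM => //; apply: subring1. Qed.

Lemma base_idealP r : R r -> (L r <-> l r).
Proof.
move=> Rr; split=> [/base_ideal_local[v [Rv nlv] lvr]|/base_ideal_sub//].
exact: (maximal_prime rR maxl Rv Rr lvr nlv).
Qed.

Lemma base_residue t : O d t -> exists2 r, R r & L (t - r).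
Proof.
move=> Tt; have [v [Rv nlv] Rvt] := locally_base Tt.
have [w Rw lw] := maximal_inv rR maxl Rv nlv.
exists (w * (v * t)); first exact: subringM.
by rewrite (_ : _ - _ = (1 - v * w) * t); [apply: set_prodM|ring].
Qed.

Lemma base_ideal_submod : submod (O d) L.
Proof. by rewrite set_prodC; apply: set_prod_submod; apply: subring_submod. Qed.

Lemma base_maximal : maximal_ideal (O d) L.
Proof.
have [gL TL] := base_ideal_submod.
apply: maximal_idealI => //.
- by apply: set_prod_sub => // a b /lR/RT Ta Tb; apply: subringM.
- by move/(base_idealP (subring1 rR)); apply: maximal_not1 maxl.
move=> t Tt nLt; have [r Rr Ltr] := base_residue Tt.
have nlr : ~ l r.
  by move/base_ideal_sub => Lr; apply: nLt; rewrite -[t](subrK r); apply: zgroupD.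
have [u Ru lu] := maximal_inv rR maxl Rr nlr; exists u; first exact: RT.
rewrite (_ : _ - _ = (1 - r * u) - u * (t - r)); last by ring.
by apply: zgroupB => //; [apply: base_ideal_sub|apply: TL => //; apply: RT].
Qed.

Lemma base_common_denominator :
  exists2 v, (R `\` l) v & forall x, O d x -> R (v * x).
Proof.
have [[n [b defT]] _] := order_lattice ordT; rewrite -/(zspan b) in defT.
have loc (i : 'I_n) : exists v, (R `\` l) v /\ R (v * b i).
  have [|v Rv Rvb] := @locally_base (b i); last by exists v.
  by rewrite defT; apply: zspan_gen.
have [v vP] := choice loc.
have Rv (i : 'I_n) : R (v i) by case: (vP i) => -[].
have [Rw nlw] : (R `\` l) (\prod_i v i).
  elim/big_ind: _ => [|x y [Rx nx] [Ry ny]|i _]; last by case: (vP i).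
    by split; [apply: subring1|apply: maximal_not1 maxl].
  by split; [apply: subringM|move/(maximal_prime rR maxl Rx Ry)/(_ nx)].
exists (\prod_i v i) => // x; rewrite {1}defT => -[c ->].
rewrite mulr_sumr; apply: (zgroup_sum gR) => i _; rewrite mulrzAr.
apply: (zgroupMz gR); rewrite (bigD1 i) //= mulrAC; apply: subringM => //.
  by case: (vP i).
by elim/big_ind: _ => // [|y z]; [apply: subring1|apply: subringM].
Qed.

Lemma base_singular : singular_maximal_ideal (O d) L.
Proof.
split; first exact: base_maximal.
move=> x fx; have [v [Rv nlv] vT] := base_common_denominator.
have Tx : O d x.
  by rewrite -[x]mulr1; apply: fx; apply: (order_integral ordT); apply: subring1.
have lvx : l (v * x).
  by case: singl => _; apply => y By; rewrite -mulrA; apply: vT; apply: fx.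
apply: (maximal_prime rT base_maximal (RT Rv) Tx); first exact: base_ideal_sub.
by move/(base_idealP Rv).
Qed.

Lemma base_nat : exists2 c : nat, (0 < c)%N & l c%:R.
Proof. exact: singular_nat_mem HK _ _ ordR singl. Qed.

Lemma ladder_order i : (i <= d)%N -> is_order (O i).
Proof. by move=> le_id; case: ladderT => _ _ /(_ (O i))[_ []]; [exists i|case]. Qed.

Lemma ladder_step i : (i < d)%N -> O i.+1 `<=` O i /\ ~ O i `<=` O i.+1.
Proof. by case: ladderT => _ lt _ _ /lt[]. Qed.

Lemma ladder_mono i j : (i <= j)%N -> (j <= d)%N -> O j `<=` O i.
Proof.
elim: j => [|j IH]; first by rewrite leqn0 => /eqP -> _ x.
rewrite leq_eqVlt => /predU1P[-> _ x //|ltij ltjd].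
apply: subset_trans (IH ltij (ltnW ltjd)).
by case: (ladder_step ltjd).
Qed.

Lemma base_sub i : (i <= d)%N -> O d `<=` O i.
Proof. by move=> le_id; apply: ladder_mono. Qed.

Lemma pow_complement (T : set K) y z k : subring T -> T y -> T z ->
  exists2 w, T w & (1 - y * z) ^+ k = 1 - y * w.
Proof.
move=> rT' Ty Tz; have gT' := subring_zgroup rT'; have T1 := subring1 rT'.
elim: k => [|k [w Tw IH]]; first by exists 0; rewrite ?mulr0 ?subr0 //; apply: zgroup0.
exists (z + w - y * z * w); last by rewrite exprS IH; ring.
by apply: zgroupB => //; [apply: zgroupD|do 2!apply: subringM => //].
Qed.

(* The conductor of [U] in the base order is primary to [L] as soon as every
   element of [L] has a power in it. *)
Lemma ladder_complete U : is_order U -> O d `<=` U ->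
  (forall x, L x -> exists k, forall u, U u -> O d (x ^+ k * u)) ->
  exists2 i, (i <= d)%N & U = O i.
Proof.
move=> ordU TU nilp; case: ladderT => _ _ compl _; apply/compl; split=> //.
set Q := colon (O d) U; have rU := order_subring ordU; have gU := subring_zgroup rU.
have maxL := base_maximal; have LT := maximal_sub maxL.
have QT : Q `<=` O d by move=> x Qx; rewrite -[x]mulr1; apply: Qx; apply: subring1.
have mQ : submod (O d) Q.
  split; first split.
  - by move=> u _; rewrite mul0r; apply: zgroup0.
  - by move=> x y Qx Qy u Uu; rewrite mulrBl; apply: zgroupB => //; [apply: Qx|apply: Qy].
  by move=> s x Ts Qx u Uu; rewrite -mulrA; apply: subringM => //; apply: Qx.
have [gQ TQ] := mQ.
have [|neqQ] := pselect (Q = O d); [by left|right].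
have Q1 : ~ Q 1.
  by move=> Q1; apply: neqQ; apply/seteqP; split=> //; apply: submod_sub1.
have unitQ y x : O d y -> ~ L y -> O d x -> Q (x * y) -> Q x.
  move=> Ty nLy Tx Qxy; have [z Tz Lz] := maximal_inv rT maxL Ty nLy.
  have [k kP] := nilp _ Lz; have [w Tw E] := pow_complement k rT Ty Tz.
  rewrite (_ : x = x * (1 - y * z) ^+ k + w * (x * y)); last by rewrite E; ring.
  by apply: (zgroupD gQ); apply: TQ.
split; first split=> //.
- exact/idealE.
- move=> x y Tx Ty Qxy; have [/nilp[k kP]|nLy] := pselect (L y); first by right; exists k.
  by left; apply: unitQ nLy Tx Qxy.
apply/seteqP; split=> [x [Tx [k Qxk]]|x Lx]; last first.
  by split; [apply: LT|have [k kP] := nilp _ Lx; exists k].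
apply: (maximal_expr rT maxL (k := k) Tx); apply: contrapT => nL; apply: Q1.
by apply: unitQ nL (subring1 rT) _; [apply: subringX|rewrite mul1r].
Qed.

Lemma multiplier_order S N c : is_order S -> (0 < c)%N -> submod S N -> N `<=` S ->
  N c%:R -> is_order (colon N N).
Proof.
move=> ordS c_gt0 mN NS Nc; have [gN SN] := mN; have rS := order_subring ordS.
have gU : zgroup (colon N N).
  split=> [y _|x y Ux Uy n Nn]; first by rewrite mul0r; apply: zgroup0.
  by rewrite mulrBl; apply: zgroupB => //; [apply: Ux|apply: Uy].
apply/orderE; split.
  split=> //; first by move=> y; rewrite mul1r.
  by move=> x y Ux Uy n Nn; rewrite -mulrA; apply: Ux; apply: Uy.
have [w cw] := natr_unit HK c_gt0.
have latN : lattice (dilate w N).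
  apply: dilate_lattice; first by exists c%:R; rewrite mulrC.
  exact: (ideal_lattice ordS c_gt0 mN NS Nc).
apply: sublattice latN c_gt0 gU _ _ => [u Uu|_ [n Nn <-] y Ny].
  by exists (u * c%:R); [apply: Uu|rewrite mulrCA [w * _]mulrC cw mulr1].
rewrite (_ : _ * _ = c%:R * w * (n * y)); last by rewrite -mulr_natr; ring.
by rewrite cw mul1r; apply: SN => //; apply: NS.
Qed.

Lemma ladder_length_gt0 : (0 < d)%N.
Proof.
rewrite lt0n; apply/eqP => d0; have maxL := base_maximal.
have [x nTx xL] := singular_multiplier HK ordT base_singular.
have [c c_gt0 lc] := base_nat.
have ordU : is_order (colon L L).
  exact: multiplier_order ordT c_gt0 base_ideal_submod (maximal_sub maxL) (base_ideal_sub lc).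
have TU : O d `<=` colon L L by move=> t Tt y Ly; apply: (maximal_mul maxL).
have [|i] := ladder_complete ordU TU.
  move=> y Ly; exists 1%N => u Uu; rewrite expr1 mulrC.
  by apply: (maximal_sub maxL); apply: Uu.
rewrite {1}d0 leqn0 => /eqP -> E; apply: nTx; rewrite {1}d0 -E.
by move=> y Ly; apply: xL.
Qed.

Record ladder_ideal i M : Prop := LadderIdeal {
  ladder_max : maximal_ideal (O i) M;
  ladder_above : M `&` O d = L;
  ladder_uniq : forall M', maximal_ideal (O i) M' -> M' `&` O d = L -> M' = M;
  ladder_colon : O i.-1 = colon M M;
  ladder_min : forall U, is_order U -> O i `<` U -> ~ U `<` O i.-1 }.

Lemma ladder_ideal_exists i : (0 < i <= d)%N -> exists M, ladder_ideal i M.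
Proof.
case: ladderT => _ _ _ /[apply] -[M [[maxM aboveM] uniqM _ colM [[_ _ minM] _]]].
by exists M.
Qed.

Lemma ladder_ideal_submod i M : ladder_ideal i M -> submod (O i.-1) M.
Proof.
move=> ladM; split; first exact: maximal_zgroup (ladder_max ladM).
by rewrite (ladder_colon ladM) => s x Ss; apply: Ss.
Qed.

Record ladder_local i M : Prop := LadderLocal {
  ladder_localI :> ladder_ideal i M;
  ladder_residue : forall t, O i t -> exists2 r, R r & M (t - r);
  ladder_extension : set_prod l (O i.-1) = M }.

Lemma ladder_base_meet i M : ladder_ideal i M -> M `&` R = l.
Proof.
move=> ladM; have aboveM := ladder_above ladM.
apply/seteqP; split=> [x [Mx Rx]|x lx].
  by apply/(base_idealP Rx); rewrite -aboveM; split=> //; apply: RT.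
by have := base_ideal_sub lx; rewrite -aboveM => -[Mx _]; split=> //; apply: lR.
Qed.

Lemma ladder_nat i M : ladder_ideal i M -> exists2 c : nat, (0 < c)%N & M c%:R.
Proof.
move=> ladM; have [c c_gt0 /base_ideal_sub] := base_nat.
by rewrite -(ladder_above ladM) => -[Mc _]; exists c.
Qed.

Lemma ladder_local_top M : ladder_ideal d M -> ladder_local d M.
Proof.
move=> ladM; have maxM := ladder_max ladM; have MT := maximal_sub maxM.
have d_gt0 := ladder_length_gt0.
have ML : M = L.
  rewrite -(ladder_above ladM); apply/seteqP; split=> [x Mx|x []//].
  by split=> //; apply: MT.
split=> //; first by rewrite ML; apply: base_residue.
have [gM SM] := ladder_ideal_submod ladM.
apply/seteqP; split.
  apply: set_prod_sub => // a b la Sb; rewrite mulrC; apply: SM => //.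
  by rewrite ML; apply: base_ideal_sub.
by rewrite {1}ML; apply: set_prodS => //; apply: ladder_mono => //; apply: leq_pred.
Qed.

Section Step.
Variables (i : nat) (M N : set K).
Hypothesis le_id : (i.+1 < d)%N.
Hypothesis ladM : ladder_local i.+2 M.
Hypothesis ladN : ladder_ideal i.+1 N.

Local Notation T := (O i.+2).
Local Notation S := (O i.+1).

Let ordTi : is_order T. Proof. exact: ladder_order. Qed.
Let ordS : is_order S. Proof. by apply: ladder_order; apply: ltnW. Qed.
Let rTi := order_subring ordTi.
Let rS := order_subring ordS.
Let gTi := subring_zgroup rTi.
Let gS := subring_zgroup rS.
Let TS : T `<=` S. Proof. by case: (ladder_step le_id). Qed.
Let maxM := ladder_max ladM.
Let gM := maximal_zgroup maxM.
Let MT := maximal_sub maxM.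
Let mM : submod S M. Proof. exact: (ladder_ideal_submod ladM). Qed.
Let SM s m : S s -> M m -> M (s * m). Proof. by case: mM => _; apply. Qed.
Let maxN := ladder_max ladN.
Let gN := maximal_zgroup maxN.
Let NS := maximal_sub maxN.

Lemma step_sub : M `<=` N.
Proof.
rewrite -(ladder_extension ladM) /=; apply: set_prod_sub => // a s la Ss.
rewrite mulrC; apply: (maximal_mul maxN) => //.
by have := base_ideal_sub la; rewrite -(ladder_above ladN) => -[].
Qed.

Lemma step_neq : M <> N.
Proof.
move=> eqMN; have [_] := ladder_step (ltnW le_id); apply.
by rewrite (ladder_colon ladN) -eqMN -(ladder_colon ladM).
Qed.

Lemma meet_proper_ideal J : submod S J -> M `<=` J -> ~ J 1 -> J `&` T = M.
Proof.
move=> [gJ SJ] MJ J1; apply/seteqP; split=> [|m Mm]; last by split; [apply: MJ|apply: MT].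
have [||m Mm|//|[]//] := @maximal_or _ _ _ rTi maxM (J `&` T).
- split; [split|]; [by split; apply: zgroup0| |].
    by move=> x y [Jx Tx] [Jy Ty]; split; apply: zgroupB.
  by move=> s x Ts [Jx Tx]; split; [apply: SJ => //; apply: TS|apply: subringM].
- by move=> x [].
by split; [apply: MJ|apply: MT].
Qed.

Let natM : exists2 c : nat, (0 < c)%N & M c%:R. Proof. exact: ladder_nat ladM. Qed.

(* [T + J] is an order strictly above [T], hence all of [S]. *)
Lemma intermediate_ideal_span J : submod S J -> J `<=` S -> M `<=` J -> ~ J 1 -> J <> M ->
  forall s, S s -> exists2 t, T t & J (s - t).
Proof.
move=> mJ JS MJ J1 neqJM; have [gJ SJ] := mJ; have [c c_gt0 Mc] := natM.
have [T1 J0] := (subring1 rTi, zgroup0 gJ).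
pose U := [set s | exists2 t, T t & J (s - t)].
have TU : T `<=` U by move=> t Tt; exists t; rewrite ?subrr.
have JU : J `<=` U by move=> y Jy; exists 0; rewrite ?subr0 //; apply: zgroup0.
have US : U `<=` S.
  by move=> s [t Tt Jst]; rewrite -[s](subrK t); apply: zgroupD => //;
    [apply: JS|apply: TS].
have gU : zgroup U.
  split; first by apply: TU; apply: zgroup0.
  move=> x y [t Tt Jt] [u Tu Ju]; exists (t - u); first exact: zgroupB.
  by rewrite (_ : _ - _ = (x - t) - (y - u)); [apply: zgroupB|ring].
have ordU : is_order U.
  apply/orderE; split.
    split=> //; first exact: TU.
    move=> x y Ux Uy; have [t Tt Jt] := Ux; have [u Tu Ju] := Uy.
    exists (t * u); first exact: subringM.
    rewrite (_ : _ - _ = y * (x - t) + t * (y - u)); last by ring.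
    by apply: zgroupD => //; apply: (SJ) => //; [apply: US|apply: TS].
  apply: sublattice (order_lattice ordS) c_gt0 gU US _ => s Ss.
  by apply/JU/MJ; rewrite -mulr_natr; apply: SM.
have TltU : T `<` U.
  split=> // UT; apply: neqJM; apply/seteqP; split=> // y Jy.
  by rewrite -(meet_proper_ideal mJ MJ J1); split=> //; apply/UT/JU.
move=> s Ss; apply: contrapT => nUs; apply: (ladder_min ladM ordU TltU).
by split=> // SU; apply: nUs; apply: SU.
Qed.

Lemma intermediate_ideal_eq J : submod S J -> J `<=` S -> M `<=` J -> ~ J 1 -> J <> M ->
  J = N.
Proof.
move=> mJ JS MJ J1 neqJM; have [gJ SJ] := mJ; apply: (ladder_uniq ladN).
  apply: maximal_idealI => // s Ss nJs.
  have [t Tt Jst] := intermediate_ideal_span mJ JS MJ J1 neqJM Ss.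
  have nMt : ~ M t by move/MJ => Jt; apply: nJs; rewrite -[s](subrK t); apply: zgroupD.
  have [u Tu Mu] := maximal_inv rTi maxM Tt nMt; exists u; first exact: TS.
  rewrite (_ : _ - _ = (1 - t * u) - u * (s - t)); last by ring.
  by apply: zgroupB => //; [apply: MJ|apply: (SJ) => //; apply: TS].
rewrite -(ladder_above ladM) -(meet_proper_ideal mJ MJ J1) -setIA.
by congr (_ `&` _); apply/esym/setIidr; apply: base_sub.
Qed.

Let N1 : ~ N 1. Proof. exact: maximal_not1 maxN. Qed.
Let mN : submod S N. Proof. exact: maximal_submod maxN. Qed.

Lemma step_span s : S s -> exists2 t, T t & N (s - t).
Proof.
apply: intermediate_ideal_span => //; first exact: step_sub.
by move/esym/step_neq.
Qed.

Lemma step_generator : exists x, [/\ S x, ~ T x, M (x * x)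
  & forall s, S s -> exists a b, [/\ T a, T b & M (s - (a + b * x))]].
Proof.
have MN := step_sub; have [c c_gt0 Mc] := natM.
have [y Ny nMy] : exists2 y, N y & ~ M y.
  apply: contrapT => nex; apply: step_neq; apply/seteqP; split=> // y Ny.
  by apply: contrapT => nMy; apply: nex; exists y.
pose J := [set s | S s /\ M (s * y)].
have mJ : submod S J.
  split; first split.
  - by split; [apply: zgroup0|rewrite mul0r; apply: zgroup0].
  - by move=> z w [Sz Mz] [Sw Mw]; split; [apply: zgroupB|rewrite mulrBl; apply: zgroupB].
  by move=> z w Sz [Sw Mw]; split; [apply: subringM|rewrite -mulrA; apply: SM].
have JN : J `<=` N.
  have [-> //|neqJM] := pselect (J = M).
  rewrite (intermediate_ideal_eq mJ _ _ _ neqJM) //.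
  - by move=> s [].
  - by move=> m Mm; split; [apply/TS/MT|rewrite mulrC; apply: SM => //; apply: NS].
  by case=> _; rewrite mul1r.
have Mcy : M (y *+ c) by rewrite -mulr_natr; apply: SM => //; apply: NS.
have [t [St nMty Nty]] := socle ordS maxN mM c_gt0 Mcy
  (fun t St Mty => JN t (conj St Mty)).
pose x := t * y; have Nx : N x by apply: (maximal_mul maxN).
have Sx : S x by apply: NS.
exists x.
have nTx : ~ T x.
  move=> Tx; apply: nMty; rewrite -(meet_proper_ideal mN MN N1); split=> //.
have Mxx : M (x * x) by apply: Nty.
split=> // s Ss; pose J' := [set z | exists2 a, T a & M (z - a * x)].
have J'N : J' `<=` N.
  move=> z [a Ta Mz]; rewrite -[z](subrK (a * x)); apply: zgroupD => //; first exact: MN.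
  by apply: (maximal_mul maxN) => //; apply: TS.
have gJ' : zgroup J'.
  split; first by exists 0; [apply: zgroup0|rewrite mul0r subr0; apply: zgroup0].
  move=> z w [a Ta Mz] [b Tb Mw]; exists (a - b); first exact: zgroupB.
  by rewrite (_ : _ - _ = (z - a * x) - (w - b * x)); [apply: zgroupB|ring].
have mJ' : submod S J'.
  split=> // u z Su [a Ta Mz]; have [v Tv Nuv] := step_span Su.
  exists (v * a); first exact: subringM.
  rewrite (_ : _ - _ = u * (z - a * x) + a * ((u - v) * x)); last by ring.
  apply: zgroupD => //; first exact: SM.
  by apply: SM; [apply: TS|apply: Nty].
have J'E : J' = N.
  apply: intermediate_ideal_eq mJ' _ _ _ _.
  - by move=> z /J'N/NS.
  - by move=> m Mm; exists 0; [apply: zgroup0|rewrite mul0r subr0].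
  - by move/J'N.
  move=> J'M; apply: nMty; rewrite -J'M; exists 1; first exact: subring1.
  by rewrite mul1r subrr; apply: zgroup0.
have [a Ta] := step_span Ss; rewrite -J'E => -[b Tb Mab].
by exists a, b; split=> //; rewrite opprD addrA.
Qed.

Lemma ladder_local_step : ladder_local i.+1 N.
Proof.
have MN := step_sub; split=> // [s Ss|].
  have [t Tt Nst] := step_span Ss; have [r Rr Mtr] := ladder_residue ladM Tt.
  by exists r => //; rewrite -[s](subrK t) -addrA; apply: zgroupD => //; apply: MN.
rewrite /=; have [SU nUS] := ladder_step (ltnW le_id).
have ordU : is_order (O i) by apply: ladder_order; apply: ltnW; apply: ltnW.
have mU : submod (O i) (set_prod l (O i)).
  by rewrite set_prodC; apply/set_prod_submod/subring_submod/order_subring.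
have UN : set_prod l (O i) `<=` N.
  apply: set_prod_sub => // a u la Uu.
  have Na : N a by have := base_ideal_sub la; rewrite -(ladder_above ladN) => -[].
  by move: Uu; rewrite mulrC (ladder_colon ladN); apply.
have MU : M `<=` set_prod l (O i) by rewrite -(ladder_extension ladM); apply: set_prodS.
apply: intermediate_ideal_eq => //.
- by case: mU => gU UU; split=> // s x /SU; apply: UU.
- by move=> x /UN/NS.
- by move/UN.
move=> eqM; apply: nUS; rewrite (ladder_colon ladM) => u Uu m Mm.
by rewrite -eqM; case: mU => _; apply=> //; rewrite eqM.
Qed.

End Step.

Lemma ladder_localP i : (0 < i <= d)%N -> exists M, ladder_local i M.
Proof.
case/andP=> i_gt0 le_id; have [k E] : exists k, (d = i + k)%N by exists (d - i)%N;
  rewrite subnKC.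
elim: k i i_gt0 {le_id} E => [|k IH] i i_gt0 E.
  rewrite addn0 in E; have [|M ladM] := @ladder_ideal_exists d.
    by rewrite leqnn andbT E.
  by exists M; rewrite -E; apply: ladder_local_top.
have [//||M ladM] := IH i.+1; first by rewrite E addnS.
have lt_id : (i < d)%N by rewrite E addnS ltnS leq_addr.
have [|N ladN] := @ladder_ideal_exists i; first by rewrite i_gt0 ltnW.
case: i i_gt0 {IH E} ladM lt_id ladN => // i _ ladM lt_id ladN.
by exists N; apply: ladder_local_step ladM ladN.
Qed.

End Ladder.

Section ClassNumbers.
Variable K : comNzRingType.
Hypothesis HK : product_of_number_fields K.
Variables (R l : set K) (d : nat) (O : nat -> set K).
Hypothesis ordR : is_order R.
Hypothesis singl : singular_maximal_ideal R l.
Hypothesis ladO : ladder_in_overorders R l d O.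
Implicit Types (S T U M N I J : set K) (x y z t s m : K) (i j k : nat).

Lemma class_number_ratio_ramified i : (2 <= i <= d)%N ->
  (class_number (O i))%:R / (class_number (O i.-1))%:R
  = (residue_card R l)%:R / (unit_index (O i.-1) (O i))%:R :> rat.
Proof.
case: i => // -[//|i] /= lt_id.
have [|M ladM] := ladder_localP HK ordR singl ladO (i := i.+2); first exact: lt_id.
have [|N ladN] := ladder_ideal_exists ladO (i := i.+1); first exact: ltnW.
have ordTi := ladder_order ladO lt_id; have ordS := ladder_order ladO (ltnW lt_id).
have [TS _] := ladder_step ladO lt_id.
have maxM := ladder_max ladM; have mM := ladder_ideal_submod ladM.
have natM := ladder_nat HK ordR singl ladO ladM.
have RTi := subset_trans (base_overorder ladO) (base_sub ladO lt_id).
have MR := ladder_base_meet ordR singl ladO ladM.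
have res := ladder_residue ladM.
have [x [Sx nTx Mxx span]] := step_generator HK ordR singl ladO lt_id ladM ladN.
have [fin card] := ramified_kernel ordR ordTi ordS TS RTi maxM mM natM MR res Sx nTx span Mxx.
rewrite -card; apply: (class_number_ratio HK ordTi ordS TS maxM mM natM _ fin).
  exact: (ramified_primitive ordTi ordS TS maxM mM Sx nTx span Mxx).
apply: ncard_gt0 fin _; exact: (kernel_nonempty ordTi ordS TS maxM mM natM).
Qed.

Section Bottom.
Variable M : set K.
Hypothesis ladM : ladder_local R l d O 1 M.

Local Notation T := (O 1%N).
Local Notation S := (O 0%N).

Let d_gt0 : (0 < d)%N. Proof. exact: (ladder_length_gt0 HK ordR singl ladO). Qed.
Let ordT : is_order T. Proof. exact: (ladder_order ladO). Qed.
Let ordS : is_order S. Proof. exact: (ladder_order ladO). Qed.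
Let rT := order_subring ordT.
Let rS := order_subring ordS.
Let gT := subring_zgroup rT.
Let gS := subring_zgroup rS.
Let TS : T `<=` S. Proof. by case: (ladder_step ladO d_gt0). Qed.
Let RT : R `<=` T.
Proof. exact: (subset_trans (base_overorder ladO) (base_sub ladO d_gt0)). Qed.
Let maxM := ladder_max ladM.
Let gM := maximal_zgroup maxM.
Let MT := maximal_sub maxM.
Let M1 := maximal_not1 maxM.
Let mM : submod S M. Proof. exact: (ladder_ideal_submod ladM). Qed.
Let SM s m : S s -> M m -> M (s * m). Proof. by case: mM => _; apply. Qed.
Let natM := ladder_nat HK ordR singl ladO ladM.
Let lS : set_prod l S = M := ladder_extension ladM.

Lemma gorenstein_generator : gorenstein_at T M ->
  exists x, [/\ S x, ~ T x & forall s, S s -> exists a b, [/\ T a, T b & s = a + b * x]].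
Proof.
case=> b [colb gen ind]; pose x := b ord0.
have colx m : M m -> T (x * m) by move=> Mm; apply: (colb ord0).
have nTx : ~ T x.
  move=> Tx; apply: M1; apply: (ind (fun=> 1)) ord0 => [_|]; first exact: subring1.
  by rewrite big_ord1 mul1r.
have span s : S s -> exists a t, [/\ T a, T t & s = a + t * x].
  move=> Ss; have [|t [Tt Ts]] := gen s.
    by move=> m Mm; apply/MT/SM.
  rewrite big_ord1 in Ts; exists (s - t ord0 * x), (t ord0); split=> //.
  by rewrite subrK.
exists x; split=> //; have [_ nST] := ladder_step ladO d_gt0.
have [s Ss nTs] : exists2 s, S s & ~ T s.
  apply: contrapT => nex; apply: nST => s Ss; apply: contrapT => nTs.
  by apply: nex; exists s.
have [a [t [Ta Tt sE]]] := span s Ss.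
apply: (maximal_cancel rT maxM (t := t)) => //.
- by move=> *; apply: subringM => //; apply: TS.
- by move=> m Mm; apply/TS; rewrite mulrC; apply: colx.
- by move=> Mt; apply: nTs; rewrite sE; apply: zgroupD => //; rewrite mulrC; apply: colx.
rewrite -[_ * x](addKr a) -sE; apply: (zgroupD gS) => //.
by apply: TS; apply: zgroupN.
Qed.

(* [(N : N)] is an order between [O_0] and the base order whose conductor is
   primary, so it is [O_0]; hence [N] is invertible, and [N^2] inside [M] forces
   equality. *)
Lemma ramified_square N n0 : submod S N -> N `<=` S -> maximal_ideal S N -> M `<=` N ->
  N n0 -> ~ M n0 -> (forall y z, N y -> N z -> M (y * z)) -> M = set_prod N N.
Proof.
move=> [gN SN] NS maxN MN Nn0 nMn0 NNM; have [c c_gt0 Mc] := natM.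
apply/seteqP; split; last by apply: set_prod_sub.
have Nc := MN _ Mc.
have ordU : is_order (colon N N) by apply: multiplier_order ordS c_gt0 _ NS Nc.
have SU : S `<=` colon N N by move=> s Ss n Nn; apply: SN.
have colN z : (forall n, N n -> N (z * n)) -> S z.
  move=> zN; have [||i le_id E] := ladder_complete ordR singl ladO ordU.
  - exact: subset_trans (base_sub ladO (leq0n d)) SU.
  - move=> x Lx; exists d.+1 => u Uu.
    have Nx : N x by apply: MN; have := Lx; rewrite -(ladder_above ladM) => -[].
    suff key j : (j <= d)%N -> O j (x ^+ j.+1 * u) by apply: key.
    elim: j => [_|j IH ltjd]; first by rewrite expr1 mulrC; apply/NS/Uu.
    have [|M' ladM'] := ladder_ideal_exists ladO (i := j.+1); first exact: ltjd.
    have Mx' : M' x by have := Lx; rewrite -(ladder_above ladM') => -[].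
    apply: (maximal_sub (ladder_max ladM')); rewrite exprS -mulrA mulrC.
    by have := IH (ltnW ltjd); rewrite -[O j]/(O j.+1.-1) (ladder_colon ladM'); apply.
  have : colon N N z by move=> n Nn; apply: zN.
  by rewrite E; apply: (ladder_mono ladO).
have [w cw] := natr_unit HK c_gt0.
have [gcS ScS] : submod S (dilate c%:R S).
  exact: dilate_submod (subring_submod rS).
have [t [St ncSt tN]] : exists t, [/\ S t, ~ dilate c%:R S (t * 1)
    & forall m, N m -> dilate c%:R S (m * (t * 1))].
  apply: (socle ordS maxN _ c_gt0) => //.
    by exists 1; [apply: subring1|rewrite mulr1].
  by move=> t St; rewrite mulr1 => -[s Ss <-]; rewrite mulrC; apply: SN.
rewrite mulr1 in ncSt; pose z := t * w.
have zNS n : N n -> S (z * n).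
  move/tN; rewrite mulr1 => -[s Ss E].
  by rewrite (_ : z * n = c%:R * w * s); [rewrite cw mul1r|rewrite -mulrA mulrCA E /z;
    ring].
have [n1 Nn1 nNzn] : exists2 n, N n & ~ N (z * n).
  apply: contrapT => nex; apply: ncSt; exists z.
    by apply: colN => n Nn; apply: contrapT => nNzn; apply: nex; exists n.
  by rewrite /z mulrCA cw mulr1.
have [u Su Nu] := maximal_inv rS maxN (zNS _ Nn1) nNzn.
pose v := z * u.
have vNS n : N n -> S (v * n) by move=> /zNS Sz; rewrite /v mulrAC; apply: subringM.
have NvM m : M m -> N (v * m).
  move=> Mm; apply: contrapT => nNvm; apply: nMn0.
  have [s Ss Ns] := maximal_inv rS maxN (vNS _ (MN _ Mm)) nNvm.
  rewrite (_ : n0 = v * n0 * s * m + (1 - v * m * s) * n0); last by ring.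
  apply: zgroupD => //; last exact: NNM.
  by apply: SM => //; apply: subringM => //; apply: vNS.
move=> m Mm; rewrite (_ : m = n1 * (v * m) + (1 - z * n1 * u) * m); last by rewrite /v;
  ring.
by apply: set_prodD; apply: set_prodM => //; [apply: NvM|apply: MN].
Qed.

Lemma class_number_ratio_bottom : gorenstein_at T M -> exists delta : int,
  splitting_symbol l S delta /\
  (class_number T)%:R / (class_number S)%:R
  = ((residue_card R l)%:R - delta%:~R) / (unit_index S T)%:R :> rat.
Proof.
move=> gor; have [x0 [Sx0 nTx0 span0]] := gorenstein_generator gor.
have MR := ladder_base_meet ordR singl ladO ladM.
have res := ladder_residue ladM.
have ratio := class_number_ratio HK ordT ordS TS maxM mM natM.
have nonempty := kernel_nonempty ordT ordS TS maxM mM natM.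
have STm t y : T t -> S y -> S (t * y) by move=> Tt Sy; apply: subringM => //; apply: TS.
have MS m : M m -> S m by move=> Mm; apply/TS/MT.
have [maxSM|nmaxSM] := pselect (maximal_ideal S M).
  have spanM s : S s -> exists a b, [/\ T a, T b & M (s - (a + b * x0))].
    move=> /span0[a [b [Ta Tb ->]]]; exists a, b; split=> //.
    by rewrite subrr; apply: zgroup0.
  have [fin card] := inert_kernel ordR ordT ordS TS RT maxM mM natM MR res Sx0 nTx0 spanM maxSM.
  exists (-1); split; first by constructor 1; rewrite /inert_in lS.
  rewrite ratio //; last exact: ncard_gt0 fin nonempty.
    by rewrite card mulrNz opprK -natr1.
  exact: (inert_primitive ordS maxM mM maxSM).
have [N [mN NS MN N1 [n0 Nn0 nMn0]]] : exists N, [/\ submod S N, N `<=` S, M `<=` N, ~ N 1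
    & exists2 n, N n & ~ M n].
  apply: contrapT => nex; apply: nmaxSM; split.
  - exact/idealE.
  - by move=> E; apply: M1; rewrite E; apply: subring1.
  move=> J /idealE[mJ JS] MJ; have [JM|nJM] := pselect (J `<=` M); first by left;
    apply/seteqP.
  right; apply/seteqP; split=> //; apply: submod_sub1 => //.
  apply: contrapT => J1; apply: nex; exists J; split=> //.
  by move/existsNP: nJM => -[y /not_implyP[]]; exists y.
have [gN SN] := mN.
have NTM y : N y -> T y -> M y.
  move=> Ny Ty; apply: contrapT => nMy; apply: N1.
  have [u Tu Mu] := maximal_inv rT maxM Ty nMy.
  rewrite -[1](subrK (y * u)); apply: zgroupD => //; first exact: MN.
  by rewrite mulrC; apply: SN => //; apply: TS.
have nTn0 : ~ T n0 by move=> Tn0; apply: nMn0; apply: NTM.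
have Sn0 := NS _ Nn0.
have span s : S s -> exists a b, [/\ T a, T b & M (s - (a + b * n0))].
  move=> Ss; have [a [b [Ta Tb E]]] := span0 s Ss;
    have [a0 [b0 [Ta0 Tb0 E0]]] := span0 n0 Sn0.
  have nMb0 : ~ M b0.
    move=> Mb0; apply: nTn0; rewrite E0; apply: zgroupD => //.
    by rewrite mulrC; apply/MT/SM.
  have [u Tu Mu] := maximal_inv rT maxM Tb0 nMb0.
  exists (a - b * u * a0), (b * u); split.
  - by apply: zgroupB => //; apply: subringM => //; apply: subringM.
  - exact: subringM.
  rewrite E E0 (_ : _ - _ = b * x0 * (1 - b0 * u)); last by ring.
  by apply: SM => //; apply: STm.
have [a [t [Ta Tt Mq]]] := span _ (subringM rS Sn0 Sn0).
have Ma : M a.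
  apply: NTM => //; rewrite (_ : a = n0 * n0 - t * n0 - (n0 * n0 - (a + t * n0)));
    last by ring.
  apply: zgroupB => //; last exact: MN.
  by apply: zgroupB => //; apply: SN => //; apply: TS.
have [Mt|nMt] := pselect (M t).
  have Mnn : M (n0 * n0).
    rewrite (_ : n0 * n0 = n0 * n0 - (a + t * n0) + a + n0 * t); last by ring.
    by apply: zgroupD => //; [apply: zgroupD|apply: SM].
  have [fin card] := ramified_kernel ordR ordT ordS TS RT maxM mM natM MR res Sn0 nTn0 span Mnn.
  have Nspan y : N y -> exists2 b, T b & M (y - b * n0).
    move=> Ny; have [a' [b [Ta' Tb My]]] := span _ (NS _ Ny); exists b => //.
    have Ma' : M a'.
      apply: NTM => //; rewrite (_ : a' = y - b * n0 - (y - (a' + b * n0))); last by ring.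
      apply: zgroupB => //; last exact: MN.
      by apply: zgroupB => //; apply: SN => //; apply: TS.
    by rewrite (_ : _ - _ = y - (a' + b * n0) + a'); [apply: zgroupD|ring].
  have NNM y z : N y -> N z -> M (y * z).
    move=> Ny Nz; have [b Tb My] := Nspan y Ny; have [b' Tb' Mz] := Nspan z Nz.
    rewrite (_ : y * z = z * (y - b * n0) + b * n0 * (z - b' * n0) + b * b' * (n0 * n0)); last by ring.
    apply: zgroupD => //; last by apply: SM => //; apply: TS; apply: subringM.
    by apply: zgroupD => //; apply: SM => //; [apply: NS|apply: STm].
  have maxN : maximal_ideal S N.
    apply: maximal_idealI => // s Ss nNs; have [a' [b [Ta' Tb Ms]]] := span s Ss.
    have nMa' : ~ M a'.
      move=> Ma'; apply: nNs; rewrite (_ : s = s - (a' + b * n0) + a' + b * n0);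
        last by ring.
      apply: zgroupD => //; last by apply: SN => //; apply: TS.
      by apply: zgroupD => //; apply: MN.
    have [u Tu Mu] := maximal_inv rT maxM Ta' nMa'; exists u; first exact: TS.
    rewrite (_ : _ - _ = (1 - a' * u) - u * (s - (a' + b * n0)) - u * b * n0);
      last by ring.
    apply: zgroupB => //; last by apply: SN => //; apply: TS; apply: subringM.
    by apply: zgroupB => //; apply: MN => //; apply: SM => //; apply: TS.
  exists 0; split.
    by constructor 2; split=> //; exists N => //; rewrite lS;
      apply: (ramified_square mN NS maxN MN Nn0).
  rewrite ratio //; last exact: ncard_gt0 fin nonempty.
    by rewrite card subr0.
  exact: (ramified_primitive ordT ordS TS maxM mM Sn0 nTn0 span Mnn).
have [u Tu Mu] := maximal_inv rT maxM Tt nMt; pose e := u * n0.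
have Se : S e by apply: STm.
have Mee : M (e * e - e).
  rewrite /e (_ : _ - _ = u * u * (n0 * n0 - (a + t * n0)) + u * u * a + (- (u * n0)) * (1 - t * u)); last by ring.
  have Su := TS Tu; have Suu : S (u * u) by apply: subringM.
  by apply: zgroupD => //; [apply: zgroupD => //|]; apply: SM => //; apply: zgroupN.
have nTe : ~ T e.
  move=> Te; apply: nTn0; rewrite (_ : n0 = t * e + n0 * (1 - t * u));
    last by rewrite /e; ring.
  by apply: zgroupD => //; [apply: subringM|apply/MT/SM].
have spane s : S s -> exists a b, [/\ T a, T b & M (s - (a + b * e))].
  move=> Ss; have [a' [b [Ta' Tb Ms]]] := span s Ss; exists a', (b * t); split=> //.
    exact: subringM.
  rewrite (_ : _ - _ = s - (a' + b * n0) + b * n0 * (1 - t * u)); last by rewrite /e;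
    ring.
  by apply: zgroupD => //; apply: SM => //; apply: STm.
have [fin card] := split_kernel ordR ordT ordS TS RT maxM mM natM MR res Se nTe spane Mee.
exists 1; split.
  constructor 3; split=> //; exists (split_ideal1 S M e), (split_ideal2 S M e).
  have [? ?] := split_ideals_maximal ordT ordS TS maxM mM Se nTe spane Mee.
  split=> //; first exact: (split_ideals_neq ordT ordS maxM mM Se nTe Mee).
  by rewrite lS; apply: (split_ideals_prod ordS TS maxM mM Se Mee).
rewrite ratio //; last exact: ncard_gt0 fin nonempty.
  by rewrite -card -natr1 addrK.
exact: (split_primitive ordT ordS TS maxM mM Se nTe spane Mee).
Qed.

End Bottom.
End ClassNumbers.

Theorem theorem5p3 (K : comNzRingType) (HK : product_of_number_fields K)
    (R l : set K) (HR : is_order R) 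
    (Hl : singular_maximal_ideal R l)
    (Hladder : exists (e : nat) (C : nat -> set K), multiplicator_ladder R l e C)
    (d : nat) (O : nat -> set K) (HO : ladder_in_overorders R l d O) :
  (forall i : nat, (2 <= i <= d)%N ->
     (class_number (O i))%:R / (class_number (O i.-1))%:R
     = (residue_card R l)%:R / (unit_index (O i.-1) (O i))%:R :> rat) /\
  (bass_at R l ->
     exists delta : int, unique (splitting_symbol l (O 0%N)) delta /\
       (class_number (O 1%N))%:R / (class_number (O 0%N))%:R
       = ((residue_card R l)%:R - delta%:~R) / (unit_index (O 0%N) (O 1%N))%:R
         :> rat).
Proof.
split; first by move=> i; apply: class_number_ratio_ramified.
move=> bass; have d_gt0 := ladder_length_gt0 HK HR Hl HO.
have [|M ladM] := ladder_localP HK HR Hl HO (i := 1%N); first by [].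
have [|delta [sym ratio]] := class_number_ratio_bottom HK HR Hl HO ladM.
  apply: bass (ladder_max ladM) (ladder_base_meet HR Hl HO ladM).
  split; first exact: (ladder_order HO d_gt0).
  exact: (subset_trans (base_overorder HO) (base_sub HO d_gt0)).
exists delta; split=> //; split=> // delta'.
apply: (splitting_symbol_unique HK _ (base_nat HK HR Hl)) => //.
exact: (ladder_order HO (leq0n d)).
Qed.
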